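(* Let $S\subset\mathbb{R}^2$ be connected, with empty interior, and proximally $C^2$. Then $S$ is either a singleton, or a $1$-dimensional manifold without boundary of class $C^2$.
   Context: For a nonempty closed set $S\subset\mathbb{R}^n$, $d_S(x):=\min_{y\in S}|x-y|$ denotes the Euclidean distance function from $S$. A set $S\subset\mathbb{R}^n$ is called proximally $C^k$ (of radius $r_S$) if it is nonempty, closed, and there exists $r_S>0$ such that $d_S$ is of class $C^k$ in the set $\{x\in\mathbb{R}^n : 0<d_S(x)<r_S\}$. Manifolds are understood as embedded submanifolds of $\mathbb{R}^2$. *)

(* Defs.v *)
From mathcomp Require Import all_boot all_order all_algebra.
From mathcomp Require Import all_classical all_reals all_analysis.
Set Implicit Arguments.
Unset Strict Implicit.
Unset Printing Implicit Defensive.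
Import Order.TTheory GRing.Theory Num.Theory numFieldNormedType.Exports.
Local Open Scope classical_set_scope.
Local Open Scope ring_scope.

(* The library norm on 'rV[R]_n is the sup norm: it induces the usual topology
   of R^n, but distances have to be computed with the Euclidean norm. *)
Definition enorm (R : realType) (n : nat) (x : 'rV[R]_n) : R :=
  Num.sqrt (\sum_(i < n) x ord0 i ^+ 2).

(* The infimum is a minimum when S is nonempty and closed. *)
Definition dist_to (R : realType) (n : nat) (S : set 'rV[R]_n)
    (x : 'rV[R]_n) : R :=
  inf [set enorm (x - y) | y in S].

(* Meant for open U, so that the derivatives at points of U only depend on the
   values of f on U. *)
Fixpoint class_C (R : realType) (n : nat) (V : normedModType R) (k : nat)
    (U : set 'rV[R]_n) (f : 'rV[R]_n -> V) : Prop :=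
  match k with
  | 0%N => forall x, U x -> {for x, continuous f}
  | k'.+1 => (forall x, U x -> differentiable f x) /\
             (forall i : 'I_n, class_C k' U ('D_(delta_mx ord0 i) f))
  end.

Definition prox_C (R : realType) (n k : nat) (S : set 'rV[R]_n) : Prop :=
  [/\ S !=set0, closed S &
      exists2 r : R, 0 < r &
        class_C k [set x | 0 < dist_to S x < r] (dist_to S : 'rV[R]_n -> R)].

Definition diffeo_C (R : realType) (n k : nat) (U V : set 'rV[R]_n)
    (phi : 'rV[R]_n -> 'rV[R]_n) : Prop :=
  [/\ class_C k U phi, set_bij U V phi &
      exists psi : 'rV[R]_n -> 'rV[R]_n,
        class_C k V psi /\ (forall x, U x -> psi (phi x) = x)].

Definition flat (R : realType) (n d : nat) : set 'rV[R]_n :=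
  [set y | forall i : 'I_n, (d <= i)%N -> y ord0 i = 0].

(* d-dimensional embedded submanifold of R^n, without boundary, of class C^k:
   near each of its points, a C^k change of coordinates of the ambient space
   straightens M to R^d x {0}. *)
Definition submanifold_C (R : realType) (n d k : nat) (M : set 'rV[R]_n) : Prop :=
  forall p, M p ->
    exists (U V : set 'rV[R]_n) (phi : 'rV[R]_n -> 'rV[R]_n),
      [/\ open U, U p, open V, diffeo_C k U V phi &
          phi @` (M `&` U) = @flat R n d `&` V].

(* Main.v *)
(* Let [r] be such that the distance [d] is C^2 where [0 < d <= r], and call a
   unit vector [v] normal to [S] at [q] when the open ball of radius [r] centred
   at [q + r v] misses [S].  Since [d] grows at unit speed along its gradient, a
   maximum principle shows that the gradient at a point projecting to [q] is
   normal at [q]; hence the cone of normals is convex.  As [S] has empty interior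
   the normals at a point meet every closed half-plane, so they contain a pair
   [n], [-n].  If they contain a third vector they contain a half-circle; if this
   is not the full circle, which would isolate the point, then on the boundary of
   the corresponding sector the second derivative of [d] is that of the distance
   to a point, so the projection onto [S] has derivative zero there, whereas two
   points of [S] with antipodal normals [v], [v'] satisfy
   [|v - v'| <= (2 / r) |q - q'|], which bounds that derivative from below.
   Hence the normals at each point are exactly [n] and [-n].  The same Lipschitz
   bound makes [S] a graph over its tangent line, and differentiating
   [grad d (q + (r / 2) v) = v] along [S] shows that the normal [v] is C^1, so
   that the graph is C^2. *)
Require Import Defs.
From HB Require Import structures.
From mathcomp Require Import all_boot all_order all_algebra.
From mathcomp Require Import all_classical all_reals all_analysis.
From mathcomp Require Import ring lra.
Import Order.TTheory GRing.Theory Num.Theory numFieldNormedType.Exports.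
Local Open Scope classical_set_scope.
Local Open Scope ring_scope.

(** The derivatives of [d] are controlled only off [S]. Second-order information is therefore read
    at distance [t] from [S], at points [q + t *: v], and carried back, which is where the factor
    [1 - t * k] in the curvature of [S] comes from. Two steps need more than the Lipschitz bound. To
    exclude a half-circle of normals at [p], the bound is applied between [p] and a nearby
    projection [q], so the normal at [q] must belong to an antipodal pair, although [q] might itself
    carry a half-circle. This is impossible near [p]: seen from each of the two points, the other
    one lies opposite to the middle of its half-circle, so the two middles are almost opposite, and
    the missing normal [- e] at [p] would be approached by normals at its neighbours, whereas
    failing to be normal is an open condition. For the graph, the bound gives at most one point of
    [S] above each point of the tangent line; existence comes from projecting a parallel segment
    onto [S] and the intermediate value theorem. *)

(** * Euclidean geometry of the plane *)

Section Plane.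
Context {R : realType}.
Implicit Types (u v w x y z : 'rV[R]_2) (a b c : R).

Definition dot u v : R :=
  u ord0 ord0 * v ord0 ord0 + u ord0 ord_max * v ord0 ord_max.

(** Rotation by a quarter turn, counterclockwise. *)
Definition perp u : 'rV[R]_2 :=
  \row_(i < 2) (if i == ord0 then - u ord0 ord_max else u ord0 ord0).

Lemma row2P u v :
  u ord0 ord0 = v ord0 ord0 -> u ord0 ord_max = v ord0 ord_max -> u = v.
Proof.
move=> h0 h1; apply/rowP => i; case: (unliftP ord_max i) => [j ->|-> //].
by rewrite (_ : lift ord_max j = ord0) //; apply/val_inj; case: j => [[]].
Qed.

Lemma perp0 u : perp u ord0 ord0 = - u ord0 ord_max.
Proof. by rewrite mxE. Qed.

Lemma perp1 u : perp u ord0 ord_max = u ord0 ord0.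
Proof. by rewrite mxE. Qed.

Definition perpE := (perp0, perp1, mxE).

Lemma dotC u v : dot u v = dot v u.
Proof. rewrite /dot; ring. Qed.

Lemma dotDl u v w : dot (u + v) w = dot u w + dot v w.
Proof. rewrite /dot !mxE; ring. Qed.

Lemma dotZl a u w : dot (a *: u) w = a * dot u w.
Proof. rewrite /dot !mxE; ring. Qed.

Lemma dotNl u w : dot (- u) w = - dot u w.
Proof. rewrite /dot !mxE; ring. Qed.

Lemma dotBl u v w : dot (u - v) w = dot u w - dot v w.
Proof. by rewrite dotDl dotNl. Qed.

Lemma dotDr u v w : dot w (u + v) = dot w u + dot w v.
Proof. by rewrite !(dotC w) dotDl. Qed.

Lemma dotZr a u w : dot w (a *: u) = a * dot w u.
Proof. by rewrite !(dotC w) dotZl. Qed.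

Lemma dotNr u w : dot w (- u) = - dot w u.
Proof. by rewrite !(dotC w) dotNl. Qed.

Lemma dotBr u v w : dot w (u - v) = dot w u - dot w v.
Proof. by rewrite !(dotC w) dotBl. Qed.

Lemma dot0l u : dot 0 u = 0.
Proof. by rewrite /dot !mxE !mul0r addr0. Qed.

Definition dotE := (dotDl, dotBl, dotZl, dotNl, dotDr, dotBr, dotZr, dotNr).

Lemma dotDD u v : dot (u + v) (u + v) = dot u u + 2 * dot u v + dot v v.
Proof. rewrite /dot !mxE; ring. Qed.

Lemma dotBB u v : dot (u - v) (u - v) = dot u u - 2 * dot u v + dot v v.
Proof. rewrite /dot !mxE; ring. Qed.

Lemma dotZZ a u : dot (a *: u) (a *: u) = a ^+ 2 * dot u u.
Proof. rewrite /dot !mxE; ring. Qed.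

Lemma dot_ge0 u : 0 <= dot u u.
Proof. by rewrite /dot -!expr2 addr_ge0 ?sqr_ge0. Qed.

Lemma dot_eq0 u : dot u u = 0 -> u = 0.
Proof.
rewrite /dot -!expr2 => /eqP; rewrite paddr_eq0 ?sqr_ge0 // !sqrf_eq0.
by move=> /andP[/eqP h0 /eqP h1]; apply: row2P; rewrite mxE.
Qed.

Lemma enormE u : enorm u = Num.sqrt (dot u u).
Proof. 
rewrite /enorm big_ord_recr big_ord1 /=; congr (Num.sqrt (_ + _)).
by rewrite expr2 (_ : widen_ord _ _ = ord0) //; exact: val_inj.
Qed.

Lemma enorm_ge0 u : 0 <= enorm u.
Proof. exact: sqrtr_ge0. Qed.

Lemma enorm_sqr u : enorm u ^+ 2 = dot u u.
Proof. by rewrite enormE sqr_sqrtr ?dot_ge0. Qed.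

Lemma enorm_le u a : 0 <= a -> dot u u <= a ^+ 2 -> enorm u <= a.
Proof.
by move=> a0 h; rewrite -(ler_pXn2r (n := 2)) ?nnegrE ?enorm_ge0 // enorm_sqr.
Qed.

Lemma enorm_ge u a : 0 <= a -> a ^+ 2 <= dot u u -> a <= enorm u.
Proof.
by move=> a0 h; rewrite -(ler_pXn2r (n := 2)) ?nnegrE ?enorm_ge0 // enorm_sqr.
Qed.

Lemma dot_le_enorm u a : enorm u <= a -> dot u u <= a ^+ 2.
Proof.
move=> h; rewrite -enorm_sqr ler_pXn2r ?nnegrE ?enorm_ge0 //.
exact: le_trans (enorm_ge0 u) h.
Qed.

Lemma enorm1 u : dot u u = 1 -> enorm u = 1.
Proof. by move=> h; rewrite enormE h sqrtr1. Qed.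

Lemma enorm0 : enorm (0 : 'rV[R]_2) = 0.
Proof. by rewrite enormE dot0l sqrtr0. Qed.

Lemma enorm_eq0 u : enorm u = 0 -> u = 0.
Proof. by move=> h; apply: dot_eq0; rewrite -enorm_sqr h expr0n. Qed.

Lemma enorm_gt0 u : u != 0 -> 0 < enorm u.
Proof.
by move=> h; rewrite lt0r enorm_ge0 andbT; apply: contra_neq h; apply: enorm_eq0.
Qed.

Lemma enormN u : enorm (- u) = enorm u.
Proof. by rewrite !enormE !dotE opprK. Qed.

Lemma enormB u v : enorm (u - v) = enorm (v - u).
Proof. by rewrite -enormN opprB. Qed.

Lemma enormZ a u : enorm (a *: u) = `|a| * enorm u.
Proof. by rewrite !enormE !dotE mulrA -expr2 sqrtrM ?sqr_ge0 // sqrtr_sqr. Qed.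

Lemma dot_sqr_le u v : dot u v ^+ 2 <= dot u u * dot v v.
Proof.
have -> : dot u u * dot v v = dot u v ^+ 2 + dot (perp u) v ^+ 2.
  by rewrite /dot !perpE; ring.
by rewrite lerDl sqr_ge0.
Qed.

Lemma dot_abs_le u v : `|dot u v| <= enorm u * enorm v.
Proof.
rewrite -(ler_pXn2r (n := 2)) ?nnegrE ?mulr_ge0 ?enorm_ge0 //.
by rewrite exprMn !enorm_sqr real_normK ?num_real // dot_sqr_le.
Qed.

Lemma dot_le u v : dot u v <= enorm u * enorm v.
Proof. exact: le_trans (ler_norm _) (dot_abs_le u v). Qed.

Lemma enormD u v : enorm (u + v) <= enorm u + enorm v.
Proof.
apply: enorm_le; first by rewrite addr_ge0 ?enorm_ge0.
rewrite !dotE sqrrD !enorm_sqr (dotC v u); have := dot_le u v; lra.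
Qed.

Lemma enorm_triangle u v w : enorm (u - w) <= enorm (u - v) + enorm (v - w).
Proof. by rewrite -(subrKA v u (- w)) enormD. Qed.

Lemma enorm_unit u : u != 0 -> dot ((enorm u)^-1 *: u) ((enorm u)^-1 *: u) = 1.
Proof.
move=> /enorm_gt0 u0; rewrite !dotE -enorm_sqr; field.
by rewrite gt_eqF.
Qed.

Lemma coord_le_enorm u i : `|u ord0 i| <= enorm u.
Proof.
apply: enorm_ge => //; rewrite real_normK ?num_real //.
case: (unliftP ord_max i) => [j ->|->]; last by rewrite /dot -!expr2 lerDr sqr_ge0.
rewrite (_ : lift ord_max j = ord0); last by apply/val_inj; case: j => [[]].
by rewrite /dot -!expr2 lerDl sqr_ge0.
Qed.

Lemma norm_le_enorm u : `|u| <= enorm u.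
Proof.
rewrite /Num.norm/= mx_normrE; apply: bigmax_le => [|[i j] _ /=]; first exact: enorm_ge0.
by rewrite ord1 coord_le_enorm.
Qed.

Lemma enorm_le_norm u : enorm u <= 2 * `|u|.
Proof.
have coord i : `|u ord0 i| <= `|u|.
  rewrite [leRHS]/Num.norm/= mx_normrE.
  exact: (le_bigmax _ (fun ij => `|u ij.1 ij.2|) (ord0, i)).
apply: enorm_le; first by rewrite mulr_ge0.
rewrite /dot -!expr2 -(real_normK (num_real (u _ ord0))).
rewrite -(real_normK (num_real (u _ ord_max))).
have := coord ord0; have := coord ord_max.
move: (normr_ge0 (u ord0 ord_max)) (normr_ge0 (u ord0 ord0)); nra.
Qed.

(** The topology is that of the sup norm, which is at most [enorm] and at least half of it; from
    here on neighbourhoods are measured with Euclidean balls. *)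
Lemma nbhs_enormP x (P : set 'rV[R]_2) :
  nbhs x P <-> exists2 e : R, 0 < e & forall y, enorm (y - x) < e -> P y.
Proof.
split=> [/nbhs_ballP[e /= e0 h]|[e e0 h]].
  exists e => // y hy; apply: h; rewrite -ball_normE /= distrC.
  exact: le_lt_trans (norm_le_enorm _) hy.
apply/nbhs_ballP; exists (e / 2) => /=; first by rewrite divr_gt0.
move=> y; rewrite -ball_normE /= => hy; apply: h; rewrite enormB.
apply: le_lt_trans (enorm_le_norm _) _.
by rewrite mulrC -ltr_pdivlMr.
Qed.

Lemma lip_continuous (f : 'rV[R]_2 -> R) (C : R) :
  (forall x y, `|f x - f y| <= C * enorm (x - y)) -> continuous f.
Proof.
move=> lf x; apply/(@cvgrPdist_le _ _ _ (nbhs x)) => e e0.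
apply/nbhs_enormP.
have C1 : 0 < `|C| + 1 by rewrite ltr_wpDl.
exists (e / (`|C| + 1)); first by rewrite divr_gt0.
move=> y hy; apply: le_trans (lf _ _) _; rewrite enormB.
apply/ltW; have : (`|C| + 1) * enorm (y - x) < e by rewrite mulrC -ltr_pdivlMr.
apply: le_lt_trans; rewrite ler_wpM2r ?enorm_ge0 //.
by rewrite (le_trans (ler_norm C)) // lerDl.
Qed.

(** Source of every extremum below: each function minimised is Lipschitz for the Euclidean norm, so
    that continuity and compactness are dealt with once. *)
Lemma lip_min (K : set 'rV[R]_2) (f : 'rV[R]_2 -> R) (M C : R) :
  closed K -> K !=set0 -> (forall x, K x -> enorm x <= M) ->
  (forall x y, `|f x - f y| <= C * enorm (x - y)) ->
  exists2 x, K x & forall y, K y -> f x <= f y.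
Proof.
move=> clK K0 bK lf.
have cK : compact K.
  apply: bounded_closed_compact => //; exists M; split; first exact: num_real.
  move=> N MN x Kx /=; apply: le_trans (norm_le_enorm _) _.
  exact: le_trans (bK _ Kx) (ltW MN).
have cf : {within K, continuous f}.
  exact: continuous_subspaceT (lip_continuous f C lf).
have [x /set_mem Kx h] := @EVT_min_rV R 2 f K K0 cK cf.
by exists x => // y Ky; apply/h/mem_set.
Qed.

Lemma enorm_lip x y z :
  `|enorm (x - y) - enorm (x - z)| <= 1 * enorm (y - z).
Proof.
rewrite mul1r ler_norml; have := enorm_triangle x z y.
have := enorm_triangle x y z; rewrite (enormB z y) => h1 h2.
by apply/andP; split; lra.
Qed.

Lemma closed_eball x a : closed [set y | enorm (x - y) <= a].
Proof.
have -> : [set y | enorm (x - y) <= a] =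
    (fun y => enorm (x - y)) @^-1` [set c | c <= a] by [].
apply: preimage_closed; last exact: closed_le.
by move=> y _; exact: (lip_continuous _ _ (enorm_lip x)).
Qed.

Lemma closed_circle : closed [set v : 'rV[R]_2 | dot v v = 1].
Proof.
have -> : [set v : 'rV[R]_2 | dot v v = 1] = (fun v => enorm (0 - v)) @^-1` [set 1].
  apply/seteqP; split=> v /=; rewrite sub0r enormN; first exact: enorm1.
  by move=> h; rewrite -enorm_sqr h expr1n.
apply: preimage_closed; last exact: closed_eq.
by move=> v _; exact: (lip_continuous _ _ (enorm_lip 0)).
Qed.

Lemma perp_unit u : dot (perp u) (perp u) = dot u u.
Proof. rewrite /dot !perpE; ring. Qed.

Lemma dot_perp u : dot (perp u) u = 0.
Proof. rewrite /dot !perpE; ring. Qed.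

Lemma lagrange u v : dot u v ^+ 2 + dot (perp u) v ^+ 2 = dot u u * dot v v.
Proof. rewrite /dot !perpE; ring. Qed.

(** Strictness in the Cauchy-Schwarz inequality expresses that [u] and [v] are linearly
    independent. *)
Lemma dot_orth0 u v z : dot z u = 0 -> dot z v = 0 ->
  dot u v ^+ 2 < dot u u * dot v v -> z = 0.
Proof.
move=> zu zv; rewrite -lagrange ltrDl => h.
have : dot (perp u) v *: z = dot z v *: perp u - dot z u *: perp v.
  by apply: row2P; rewrite /dot !perpE; ring.
rewrite zu zv !scale0r subr0 => /eqP; rewrite scaler_eq0 => /orP[|/eqP //].
by move=> /eqP k0; rewrite k0 expr0n /= ltxx in h.
Qed.

Lemma orth_decomp u v w : dot u u = 1 -> dot v v = 1 -> dot u v = 0 ->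
  w = dot w u *: u + dot w v *: v.
Proof.
move=> u1 v1 uv; apply/subr0_eq; apply: (dot_orth0 u v).
- by rewrite dotBl dotDl !dotZl u1 (dotC v) uv; ring.
- by rewrite dotBl dotDl !dotZl v1 uv; ring.
- by rewrite u1 v1 uv expr0n /= mulr1.
Qed.

(** The Gram determinant of three vectors of the plane vanishes; this is that relation for unit
    vectors. *)
Lemma gram u v z : dot u u = 1 -> dot v v = 1 -> dot z z = 1 ->
  dot z u ^+ 2 + dot z v ^+ 2 - 2 * dot u v * dot z u * dot z v
  = 1 - dot u v ^+ 2.
Proof.
move=> u1 v1 z1; have : dot z z * (dot u u * dot v v - dot u v ^+ 2)
  = dot z u ^+ 2 * dot v v + dot z v ^+ 2 * dot u u
    - 2 * dot u v * dot z u * dot z v.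
  by rewrite /dot; ring.
by rewrite u1 v1 z1; lra.
Qed.

(* The reals [c], [x], [y] are the cosines of the angles between three unit
   vectors of the plane, [c] being the smallest one. *)
Lemma cos_obtuse (c x y : R) : - 1 < c -> c <= y -> x + y <= 0 -> c <= 0 ->
  x ^+ 2 + y ^+ 2 - 2 * c * x * y = 1 - c ^+ 2 -> x <= c * y.
Proof.
move=> c1 cy xy c0 g; rewrite leNgt; apply/negP => h.
have e : (x - c * y) ^+ 2 = (1 - c ^+ 2) * (1 - y ^+ 2).
  by rewrite sqrrB; move: g; lra.
have h1 : x - c * y <= - y * (1 + c) by lra.
have h2 : (x - c * y) ^+ 2 <= (- y * (1 + c)) ^+ 2.
  by rewrite ler_pXn2r // ?nnegrE; lra.
have y0 : y < 0.
  have : 0 < - y * (1 + c) by lra.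
  by rewrite pmulr_lgt0; lra.
have cy2 : y ^+ 2 <= c ^+ 2.
  rewrite -[y ^+ 2]sqrrN -[c ^+ 2]sqrrN ler_pXn2r // ?nnegrE; lra.
have h3 : (1 + c) * ((1 - c) * (1 - y ^+ 2)) <= (1 + c) * ((1 + c) * y ^+ 2).
  by move: h2; rewrite e; lra.
rewrite ler_pM2l in h3; last by lra.
(* [h3] and [y ^+ 2 <= c ^+ 2] give [1 - c <= 2 * c ^+ 2], which says that this product is at most
   0. *)
have : 0 < (1 + c) * (1 - 2 * c) by rewrite mulr_gt0; lra.
by lra.
Qed.

Lemma unit_anti u v : dot u u = 1 -> dot v v = 1 -> dot u v = - 1 -> v = - u.
Proof.
move=> u1 v1 c; apply/eqP; rewrite -addr_eq0; apply/eqP/dot_eq0.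
by rewrite dotDD (dotC v) u1 v1 c; ring.
Qed.

(** Up to sign, the plane has one unit vector orthogonal to [u], and [0 <= dot v w] excludes
    opposite signs. Quantitatively, [v + w] and [v - w] are orthogonal, [v + w] is long and almost
    orthogonal to [u], so [u] points almost along [v - w]; as [dot u (v - w)] is small, [v - w] is
    short. *)
Lemma almost_orth a u v w : 0 <= a -> a <= 1 / 2 ->
  dot v v = 1 -> dot w w = 1 -> 0 <= dot v w -> u != 0 ->
  `|dot u v| <= a * enorm u -> `|dot u w| <= a * enorm u ->
  enorm (v - w) <= 4 * a.
Proof.
move=> a0 a2 v1 w1 vw u0 uv uw.
set U := dot u u; have U0 : 0 < U by rewrite /U -enorm_sqr exprn_gt0 // enorm_gt0.
pose s := v + w; pose z := v - w.
have zs : dot z s = 0 by rewrite /z /s !dotE v1 w1 (dotC w v); ring.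
have ss : 2 <= dot s s by rewrite /s dotDD v1 w1; lra.
have bound x : `|dot u x| <= 2 * a * enorm u -> dot u x ^+ 2 <= 4 * a ^+ 2 * U.
  move=> h; rewrite -real_normK ?num_real // /U -enorm_sqr.
  rewrite (_ : 4 * _ * _ = (2 * a * enorm u) ^+ 2); last by ring.
  by rewrite ler_pXn2r ?nnegrE // !mulr_ge0 ?enorm_ge0.
have us : dot u s ^+ 2 <= 4 * a ^+ 2 * U.
  apply: bound; rewrite /s dotDr; apply: le_trans (ler_normD _ _) _; lra.
have uz : dot u z ^+ 2 <= 4 * a ^+ 2 * U.
  apply: bound; rewrite /z dotBr; apply: le_trans (ler_normB _ _) _; lra.
have a4 : 4 * a ^+ 2 <= 1.
  have : a ^+ 2 <= (1 / 2) ^+ 2 by rewrite ler_pXn2r ?nnegrE //; lra.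
  lra.
apply: enorm_le; first by rewrite mulr_ge0.
rewrite -/z.
have id1 : dot z z * (dot s s * U - dot u s ^+ 2)
  = dot u z ^+ 2 * dot s s + U * dot z s ^+ 2 - 2 * dot u z * dot u s * dot z s.
  by rewrite /U /dot; ring.
rewrite zs expr0n /= !mulr0 addr0 subr0 in id1.
have zz := dot_ge0 z; have ss0 : 0 < dot s s by lra.
have us1 : dot u s ^+ 2 <= dot s s * U / 2.
  have : 4 * a ^+ 2 * U <= 1 * U by rewrite ler_pM2r.
  have : 2 * U <= dot s s * U by rewrite ler_pM2r.
  by lra.
have h1 : dot z z * (dot s s * U / 2) <= dot z z * (dot s s * U - dot u s ^+ 2).
  by rewrite ler_wpM2l //; lra.
have h2 : dot u z ^+ 2 * dot s s <= 4 * a ^+ 2 * U * dot s s by rewrite ler_pM2r.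
have : dot z z * (dot s s * U) <= 8 * a ^+ 2 * (dot s s * U) by lra.
rewrite ler_pM2r ?mulr_gt0 // => /le_trans; apply.
by have := sqr_ge0 a; lra.
Qed.

(** The coordinates of [u] in the basis [v], [w] lie on the unit circle, and the first is at most
    [a] in absolute value, so the second is near 1 or -1; its lower bound selects 1. Below [1 - a]
    the sum of squares would be less than [a ^+ 2 + (1 - a) ^+ 2 <= 1]. *)
Lemma almost_parallel a u v w : 0 <= a -> a < 1 / 2 ->
  dot u u = 1 -> dot v v = 1 -> dot w w = 1 -> dot v w = 0 ->
  `|dot u v| <= a -> - a <= dot u w -> dot (u - w) (u - w) <= 2 * a.
Proof.
move=> a0 a2 u1 v1 w1 vw; rewrite ler_norml => /andP[h1 h2] h3.
have e : dot u v ^+ 2 + dot u w ^+ 2 = 1.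
  have := u1; rewrite {1 2}(orth_decomp v w u v1 w1 vw).
  by rewrite dotDD !dotZZ dotZl dotZr v1 w1 vw; lra.
rewrite dotBB u1 w1; move: (dot u v) (dot u w) h1 h2 h3 e => x y h1 h2 h3 e.
suff : 1 - a <= y by lra.
rewrite leNgt; apply/negP => h4.
have : x ^+ 2 <= a ^+ 2.
  have : 0 <= (a - x) * (a + x) by rewrite mulr_ge0; lra.
  lra.
have : 0 < (1 - a - y) * (1 - a + y) by rewrite mulr_gt0; lra.
have := mulr_ge0 a0 a0; nra.
Qed.

End Plane.

(** * Gradient and second derivative of functions on the plane *)

Section Derivatives.
Context {R : realType}.
Implicit Types (u v w x y z : 'rV[R]_2) (a b c : R).

Definition grad (f : 'rV[R]_2 -> R) x : 'rV[R]_2 :=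
  \row_(i < 2) 'D_(delta_mx ord0 i) f x.

(** Derivative of [dot (grad f) v] in the direction [u]: the first vector is the direction of
    differentiation. It is assembled from the gradients of the two partial derivatives. *)
Definition hess (f : 'rV[R]_2 -> R) x u v : R :=
  dot (grad ('D_(delta_mx ord0 ord0) f) x) u * v ord0 ord0 +
  dot (grad ('D_(delta_mx ord0 ord_max) f) x) u * v ord0 ord_max.

Lemma diff_grad (f : 'rV[R]_2 -> R) x u :
  differentiable f x -> 'd f x u = dot (grad f x) u.
Proof.
move=> df; rewrite /dot !mxE !deriveE //.
have {1}-> : u = u ord0 ord0 *: delta_mx ord0 ord0
            + u ord0 ord_max *: delta_mx ord0 ord_max.
  by apply: row2P; rewrite !mxE /= ?(mulr1, mulr0, addr0, add0r).
by rewrite linearD !linearZ /= ![_ *: _]mulrC.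
Qed.

Lemma diff_expansion (f : 'rV[R]_2 -> R) x :
  differentiable f x -> forall e : R, 0 < e -> exists2 del : R, 0 < del &
  forall z, enorm z < del ->
    `|f (x + z) - f x - dot (grad f x) z| <= e * enorm z.
Proof.
move=> df e e0.
have /eqaddoP/(_ e e0) := diff_locally df.
move=> /nbhs_enormP[del del0 h]; exists del => // z zd.
have := h z; rewrite subr0 => /(_ zd) /=.
rewrite !fctE /= -diff_grad // opprD addrA (addrC z) => /le_trans; apply.
by rewrite ler_wpM2l ?norm_le_enorm // ltW.
Qed.

Lemma grad_coord (f : 'rV[R]_2 -> R) x i :
  grad f x ord0 i = 'D_(delta_mx ord0 i) f x.
Proof. exact: mxE. Qed.

Lemma dot_grad (f : 'rV[R]_2 -> R) x u : dot (grad f x) u =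
  'D_(delta_mx ord0 ord0) f x * u ord0 ord0 +
  'D_(delta_mx ord0 ord_max) f x * u ord0 ord_max.
Proof. by rewrite -2!grad_coord. Qed.

Lemma hess_coord (f : 'rV[R]_2 -> R) x u v : hess f x u v =
  ('D_(delta_mx ord0 ord0) ('D_(delta_mx ord0 ord0) f) x * u ord0 ord0 +
   'D_(delta_mx ord0 ord_max) ('D_(delta_mx ord0 ord0) f) x * u ord0 ord_max)
    * v ord0 ord0 +
  ('D_(delta_mx ord0 ord0) ('D_(delta_mx ord0 ord_max) f) x * u ord0 ord0 +
   'D_(delta_mx ord0 ord_max) ('D_(delta_mx ord0 ord_max) f) x * u ord0 ord_max)
    * v ord0 ord_max.
Proof. congr (_ * _ + _ * _); exact: dot_grad. Qed.

Lemma hessDl f x u v w : hess f x (u + v) w = hess f x u w + hess f x v w.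
Proof.
have aux (A B : 'rV[R]_2) : dot A (u + v) * w ord0 ord0 + dot B (u + v) * w ord0 ord_max
  = dot A u * w ord0 ord0 + dot B u * w ord0 ord_max
    + (dot A v * w ord0 ord0 + dot B v * w ord0 ord_max).
  by rewrite !dotDr; ring.
exact: aux.
Qed.

Lemma hessZl f x a u w : hess f x (a *: u) w = a * hess f x u w.
Proof.
have aux (A B : 'rV[R]_2) : dot A (a *: u) * w ord0 ord0 + dot B (a *: u) * w ord0 ord_max
  = a * (dot A u * w ord0 ord0 + dot B u * w ord0 ord_max).
  by rewrite !dotZr; ring.
exact: aux.
Qed.

Lemma pair_expansion (D0 D1 : 'rV[R]_2 -> R) x v :
  differentiable D0 x -> differentiable D1 x -> dot v v = 1 ->
  forall e : R, 0 < e -> exists2 del : R, 0 < del &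
  forall z, enorm z < del ->
    `|(D0 (x + z) - D0 x) * v ord0 ord0 + (D1 (x + z) - D1 x) * v ord0 ord_max
      - (dot (grad D0 x) z * v ord0 ord0 + dot (grad D1 x) z * v ord0 ord_max)|
    <= e * enorm z.
Proof.
move=> df0 df1 v1 e e0; have e2 : 0 < e / 2 by rewrite divr_gt0.
have [d0 d00 h0] := diff_expansion _ _ df0 _ e2.
have [d1 d10 h1] := diff_expansion _ _ df1 _ e2.
exists (Num.min d0 d1); first by rewrite lt_min d00.
move=> z; rewrite lt_min => /andP[/h0 + /h1].
move: (D0 _ - _) (D1 _ - _) (dot _ z) (dot _ z) => a0 a1 b1 b0 hA hB.
rewrite (_ : _ - _ = (a0 - b0) * v ord0 ord0 + (a1 - b1) * v ord0 ord_max);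
  last by ring.
have c0 := coord_le_enorm v ord0; have c1 := coord_le_enorm v ord_max.
rewrite enorm1 // in c0 c1.
apply: le_trans (ler_normD _ _) _; rewrite !normrM.
have -> : e * enorm z = e / 2 * enorm z * 1 + e / 2 * enorm z * 1 by field.
by apply: lerD; apply: ler_pM.
Qed.

Lemma hess_expansion (f : 'rV[R]_2 -> R) x v :
  (forall i : 'I_2, differentiable ('D_(delta_mx ord0 i) f) x) ->
  dot v v = 1 ->
  forall e : R, 0 < e -> exists2 del : R, 0 < del &
  forall z, enorm z < del ->
    `|dot (grad f (x + z) - grad f x) v - hess f x z v| <= e * enorm z.
Proof.
move=> df v1 e e0.
have [del del0 h] := pair_expansion _ _ _ _ (df ord0) (df ord_max) v1 _ e0.
exists del => // z /h; rewrite /hess.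
rewrite (_ : dot (grad f (x + z) - grad f x) v =
  ('D_(delta_mx ord0 ord0) f (x + z) - 'D_(delta_mx ord0 ord0) f x)
    * v ord0 ord0 +
  ('D_(delta_mx ord0 ord_max) f (x + z) - 'D_(delta_mx ord0 ord_max) f x)
    * v ord0 ord_max) //.
by rewrite {1}/dot !mxE.
Qed.

Lemma grad_continuous (f : 'rV[R]_2 -> R) x :
  (forall i : 'I_2, differentiable ('D_(delta_mx ord0 i) f) x) ->
  forall e : R, 0 < e -> exists2 del : R, 0 < del &
  forall z, enorm z < del -> enorm (grad f (x + z) - grad f x) <= e.
Proof.
move=> df e e0; have e2 : 0 < e / 2 by rewrite divr_gt0.
have comp (i : 'I_2) : exists2 del : R, 0 < del & forall z, enorm z < del ->
    `|grad f (x + z) ord0 i - grad f x ord0 i| <= e / 2.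
  have := differentiable_continuous (df i).
  move=> /(@cvgrPdist_le _ _ _ (nbhs x))/(_ _ e2)/nbhs_enormP[del del0 h].
  exists del => // z hz; have := h (x + z).
  by rewrite (addrC x) addrK => /(_ hz); rewrite distrC !mxE.
have [d0 d00 h0] := comp ord0; have [d1 d10 h1] := comp ord_max.
exists (Num.min d0 d1); first by rewrite lt_min d00.
move=> z; rewrite lt_min => /andP[/h0 {}h0 /h1 {}h1].
apply: enorm_le; first exact: ltW.
have sq c : `|c| <= e / 2 -> c * c <= (e / 2) ^+ 2.
  move=> hc; rewrite -expr2 -real_normK ?num_real // ler_pXn2r ?nnegrE //.
  exact: ltW.
move: (grad f (x + z)) (grad f x) h0 h1 => A B /sq s0 /sq s1.
rewrite /dot !mxE; have := sqr_ge0 e; lra.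
Qed.

End Derivatives.

(** * Calculus of class C^k, and the chart that straightens a graph *)

Section ClassC.
Context {R : realType}.
Implicit Types (V : normedModType R) (a b c : R).

Lemma near_eq_differentiable (U V : normedModType R) (f g : U -> V) (x : U) :
  (\near x, f x = g x) -> differentiable f x -> differentiable g x.
Proof.
move=> fg df; have [fc fe] := (diff_locallyP _ _).1 df.
have ge : g \o shift x = cst (g x) + 'd f x +o_ 0 id.
  apply/eqaddoP => e e0; have /eqaddoP/(_ e e0) := fe.
  have gx : g x = f x by rewrite (nbhs_singleton fg).
  have {}fg : \forall h \near 0, f (h + x) = g (h + x).
    by move: fg; rewrite (near_shift 0) /= subr0.
  by apply: filterS2 fg => h /= hE; rewrite !fctE /= hE gx.
by apply/diff_locallyP; rewrite (diff_unique fc ge).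
Qed.

(** Formulas for partial derivatives hold only on [U], while [class_C] recurses on globally defined
    functions; this lemma substitutes such a formula at each order. *)
Lemma class_C_ext n V k (U : set 'rV[R]_n) (f g : 'rV[R]_n -> V) :
  open U -> (forall x, U x -> f x = g x) -> class_C k U f -> class_C k U g.
Proof.
move=> oU; elim: k f g => [|k IH] f g fg.
  move=> h x Ux; have nfg : {near x, f =1 g}.
    by apply: filterS (open_nbhs_nbhs (conj oU Ux)) => y /fg.
  rewrite /prop_for /continuous_at -fg //.
  exact: cvg_trans (near_eq_cvg nfg) (h x Ux).
have nfg x : U x -> \near x, f x = g x.
  by move=> Ux; apply: filterS (open_nbhs_nbhs (conj oU Ux)) => y /fg.
move=> [h1 h2]; split.
  move=> x Ux; apply: near_eq_differentiable (h1 x Ux); exact: nfg.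
move=> i; apply: IH (h2 i) => x Ux; apply: near_eq_derive; exact: nfg.
Qed.

Lemma class_CD n V k (U : set 'rV[R]_n) (f g : 'rV[R]_n -> V) :
  open U -> class_C k U f -> class_C k U g -> class_C k U (f + g).
Proof.
move=> oU; elim: k f g => [|k IH] f g.
  by move=> hf hg x Ux; exact: cvgD (hf x Ux) (hg x Ux).
move=> [f1 f2] [g1 g2]; split=> [x Ux|i].
  by apply: differentiableD; [exact: f1|exact: g1].
apply: class_C_ext (IH _ _ (f2 i) (g2 i)) => // x Ux.
by rewrite deriveD //; apply/diff_derivable; [exact: f1|exact: g1].
Qed.

Lemma dot_diff (t x : 'rV[R]_2) b :
  is_diff x (fun y => dot y t - b) (fun y => dot y t).
Proof.
have lin : linear (fun y : 'rV[R]_2 => dot y t).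
  by move=> a u v; rewrite dotDl dotZl.
pose M := GRing.isLinear.Build _ _ _ _ _ lin.
pose f : {linear 'rV[R]_2 -> R} := HB.pack (fun y : 'rV[R]_2 => dot y t) M.
have cf : continuous f.
  apply: (lip_continuous f (enorm t)) => y z /=.
  by rewrite -dotBl mulrC dot_abs_le.
have df : is_diff x f f by apply: DiffDef; [exact: linear_differentiable|rewrite diff_lin].
have -> : (fun y => dot y t - b) = (f : 'rV[R]_2 -> R) + cst (- b) by [].
have -> : (fun y => dot y t) = (f : 'rV[R]_2 -> R) + 0 by rewrite addr0.
exact: is_diffD.
Qed.

Lemma ridge_diff V (t x : 'rV[R]_2) b (h : R -> R) (h1 : R) (v : V) :
  is_derive (dot x t - b) 1 h h1 ->
  is_diff x (fun y => h (dot y t - b) *: v) (fun u => (h1 * dot u t) *: v).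
Proof.
move=> [hd hE]; have dl := dot_diff t x b.
have dh : differentiable h (dot x t - b) by apply/derivable1_diffP.
have dc : differentiable (h \o (fun y => dot y t - b)) x.
  exact: differentiable_comp.
apply: DiffDef; first exact: differentiableZl.
rewrite diffZl // diff_comp //.
have [_ dlE] := dl; apply/funext => u /=; rewrite dlE.
rewrite -hE deriveE // mulrC; congr (_ *: _).
by rewrite -{1}(mulr1 (dot u t)); exact: linearZ.
Qed.

Lemma dot_continuous (t x : 'rV[R]_2) b :
  {for x, continuous (fun y : 'rV[R]_2 => dot y t - b)}.
Proof. by have [dl _] := dot_diff t x b; exact: differentiable_continuous dl. Qed.

(** A partial derivative of a ridge function [h (dot y t - b) *: v] is again one, with [h]
    differentiated and [v] rescaled, so the recursion of [class_C] stays inside this family. The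
    charts used below are sums of ridge functions. *)
Lemma ridge_class_C V (U : set 'rV[R]_2) (t : 'rV[R]_2) b (h h1 h2 : R -> R) (v : V) :
  open U ->
  (forall x, U x -> is_derive (dot x t - b) 1 h (h1 (dot x t - b))) ->
  (forall x, U x -> is_derive (dot x t - b) 1 h1 (h2 (dot x t - b))) ->
  (forall x, U x -> {for dot x t - b, continuous h2}) ->
  class_C 2 U (fun y => h (dot y t - b) *: v).
Proof.
move=> oU dh dh1 ch2.
have step (f f1 : R -> R) (w : V) k :
    (forall x, U x -> is_derive (dot x t - b) 1 f (f1 (dot x t - b))) ->
    (forall w' : V, class_C k U (fun y => f1 (dot y t - b) *: w')) ->
  class_C k.+1 U (fun y => f (dot y t - b) *: w).
  move=> df hf1.
  have D x : U x ->
      is_diff x (fun y => f (dot y t - b) *: w)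
                (fun u => (f1 (dot x t - b) * dot u t) *: w).
    by move=> Ux; apply: ridge_diff; exact: df.
  split=> [x Ux|i]; first by have [] := D x Ux.
  apply: class_C_ext (hf1 (dot (delta_mx ord0 i) t *: w)) => // x Ux.
  by have [dx Ex] := D x Ux; rewrite deriveE // Ex scalerA.
apply: (step h h1 v 1%N) => // w1; apply: (step h1 h2 w1 0%N) => // w x Ux.
have c2 : {for x, continuous (h2 \o (fun y => dot y t - b))}.
  exact: continuous_comp (dot_continuous t x b) (ch2 _ Ux).
exact: cvgZr_tmp c2.
Qed.

Lemma affine_class_C V (U : set 'rV[R]_2) (t : 'rV[R]_2) b (v : V) :
  open U -> class_C 2 U (fun y => (dot y t - b) *: v).
Proof.
move=> oU; apply: (ridge_class_C _ _ _ b id (fun=> 1) (fun=> 0)) => //= x _.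
exact: cst_continuous.
Qed.

Lemma cst_class_C V (U : set 'rV[R]_2) (v : V) :
  open U -> class_C 2 U (fun=> v).
Proof.
move=> oU; rewrite (_ : (fun=> v) = (fun y => (fun=> 1) (dot y 0 - 0) *: v)).
  apply: (ridge_class_C _ _ 0 0 (fun=> 1) (fun=> 0) (fun=> 0)) => //= x _.
  exact: cst_continuous.
by apply/funext => y; rewrite scale1r.
Qed.

Lemma abs_lt_open (W : set 'rV[R]_2) (f : 'rV[R]_2 -> R) a :
  open W -> (forall x, W x -> {for x, continuous f}) ->
  open (W `&` [set x | `|f x| < a]).
Proof.
move=> oW cf; rewrite openE => x [Wx fx]; rewrite /interior.
have nl : {for x, continuous (fun y : 'rV[R]_2 => `|f y|)}.
  exact: cvg_norm (cf _ Wx).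
apply: filterI; first exact: open_nbhs_nbhs.
exact: (cvgr_lt _ nl _ fx).
Qed.

(** The chart is a shear: coordinates along [perp n] and [n] around [p], with the height [g]
    subtracted from the second. It maps the window on which [g] is regular and [S] is the graph onto
    a rectangle. *)
Lemma graph_chart (S : set 'rV[R]_2) (p n : 'rV[R]_2) a b (g g1 g2 : R -> R) :
  dot n n = 1 -> 0 < a -> 0 < b -> g 0 = 0 ->
  (forall s : R, `|s| < a -> is_derive s 1 g (g1 s)) ->
  (forall s : R, `|s| < a -> is_derive s 1 g1 (g2 s)) ->
  (forall s : R, `|s| < a -> {for s, continuous g2}) ->
  (forall x, `|dot (x - p) (perp n)| < a ->
     `|dot (x - p) n - g (dot (x - p) (perp n))| < b ->
     S x <-> dot (x - p) n = g (dot (x - p) (perp n))) ->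
  exists (U V : set 'rV[R]_2) (phi : 'rV[R]_2 -> 'rV[R]_2),
    [/\ open U, U p, open V, diffeo_C 2 U V phi &
        phi @` (S `&` U) = @flat R 2 1 `&` V].
Proof.
move=> n1 a0 b0 g0 dg dg1 cg2 HS.
pose e0 : 'rV[R]_2 := delta_mx ord0 ord0.
pose e1 : 'rV[R]_2 := delta_mx ord0 ord_max.
pose t := perp n.
have dote0 y : dot y e0 = y ord0 ord0.
  by rewrite /dot !mxE /= mulr1 mulr0 addr0.
have dote1 y : dot y e1 = y ord0 ord_max.
  by rewrite /dot !mxE /= mulr1 mulr0 add0r.
(* Both maps are spelled out as sums of constant, affine and ridge functions; the subtracted 0 in
   [psi] is the shift that this form requires. *)
pose phi x : 'rV[R]_2 := (dot x t - dot p t) *: e0 +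
  ((dot x n - dot p n) *: e1 + g (dot x t - dot p t) *: (- e1)).
pose psi y : 'rV[R]_2 := p + ((dot y e0 - 0) *: t +
  ((dot y e1 - 0) *: n + g (dot y e0 - 0) *: n)).
have phi0 x : phi x ord0 ord0 = dot (x - p) t.
  by rewrite dotBl /phi !mxE /=; ring.
have phi1 x : phi x ord0 ord_max = dot (x - p) n - g (dot (x - p) t).
  by rewrite !dotBl /phi !mxE /=; ring.
have psiB y : psi y - p = y ord0 ord0 *: t
    + (y ord0 ord_max + g (y ord0 ord0)) *: n.
  by rewrite /psi !dote0 !dote1 !subr0 addrC addKr scalerDl.
have tt : dot t t = 1 by rewrite -n1 /dot /t !perpE; ring.
have tn : dot t n = 0 by rewrite /dot /t !perpE; ring.
have nt : dot n t = 0 by rewrite dotC.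
have psit y : dot (psi y - p) t = y ord0 ord0.
  by rewrite psiB !dotE tt nt; ring.
have psin y : dot (psi y - p) n = y ord0 ord_max + g (y ord0 ord0).
  by rewrite psiB !dotE tn n1; ring.
have phipsi y : phi (psi y) = y.
  by apply: row2P; rewrite ?phi0 ?phi1 ?psit ?psin; ring.
have dec x : x = dot x t *: t + dot x n *: n.
  have n1' : n ord0 ord0 * n ord0 ord0 = 1 - n ord0 ord_max * n ord0 ord_max.
    by rewrite -n1 /dot; ring.
  apply: row2P; rewrite /dot /t !perpE; ring: n1'.
have psiphi x : psi (phi x) = x.
  apply/(addIr (- p)); rewrite psiB phi0 phi1 [RHS]dec.
  by congr (_ + _ *: _); ring.
pose W := setT `&` [set x | `|dot x t - dot p t| < a].
pose U := W `&` [set x | `|dot x n - dot p n - g (dot x t - dot p t)| < b].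
pose W' := setT `&` [set y | `|dot y e0 - 0| < a].
pose V := W' `&` [set y | `|dot y e1 - 0| < b].
have oW : open W by apply: abs_lt_open => [|x _]; [exact: openT|exact: dot_continuous].
have oW' : open W' by apply: abs_lt_open => [|x _]; [exact: openT|exact: dot_continuous].
have UE x : U x <-> `|dot (x - p) t| < a /\ `|dot (x - p) n - g (dot (x - p) t)| < b.
  by rewrite !dotBl; split=> [[[]]|[]].
have VE y : V y <-> `|y ord0 ord0| < a /\ `|y ord0 ord_max| < b.
  by rewrite /V /W' /= dote0 dote1 !subr0; split=> [[[]]|[]].
have UV x : U x <-> V (phi x) by rewrite UE VE phi0 phi1.
have oU : open U.
  apply: abs_lt_open => // x [_ Wx].
  have cgx : {for x, continuous (g \o (fun y => dot y t - dot p t))}.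
    apply: continuous_comp; first exact: dot_continuous.
    by apply/differentiable_continuous/derivable1_diffP; have [] := dg _ Wx.
  exact: cvgB (dot_continuous n x (dot p n)) cgx.
have oV : open V by apply: abs_lt_open => // x _; exact: dot_continuous.
exists U, V, phi; split; [exact: oU| |exact: oV| |].
- by apply/UE; rewrite !subrr !dot0l g0 subrr normr0.
- split.
  + apply: (class_CD _ _ _ _ _ _ oU); first exact: affine_class_C.
    apply: (class_CD _ _ _ _ _ _ oU); first exact: affine_class_C.
    by apply: (ridge_class_C _ _ _ _ g g1 g2 _ oU) => x [[_ Wx] _];
      [exact: dg|exact: dg1|exact: cg2].
  + split=> [x /UV //|x y _ _ h|y Vy]; first by rewrite -(psiphi x) h psiphi.
    by exists (psi y); rewrite ?phipsi //; apply/UV; rewrite phipsi.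
  + exists psi; split; last by move=> x _; exact: psiphi.
    apply: (class_CD _ _ _ _ _ _ oV); first exact: cst_class_C.
    apply: (class_CD _ _ _ _ _ _ oV); first exact: affine_class_C.
    apply: (class_CD _ _ _ _ _ _ oV); first exact: affine_class_C.
    by apply: (ridge_class_C _ _ _ _ g g1 g2 _ oV) => x [[_ Wx] _];
      [exact: dg|exact: dg1|exact: cg2].
- apply/seteqP; split=> [_ [x [Sx Ux] <-]|y [fy Vy]].
    split; last exact/UV.
    move=> i hi; have -> : i = ord_max by apply/val_inj; case: i hi => [[|[]]].
    have [h1 h2] := (UE x).1 Ux; rewrite phi1.
    by have := (HS x h1 h2).1 Sx => ->; rewrite subrr.
  have Upsi : U (psi y) by apply/UV; rewrite phipsi.
  exists (psi y) => //; split=> //; have [h1 h2] := (UE _).1 Upsi.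
  by apply/(HS _ h1 h2); rewrite psit psin (fy ord_max) // add0r.
Qed.

End ClassC.

(** * The distance to a closed set: projections and gradient *)

Section Distance.
Context {R : realType} {S : set 'rV[R]_2}.
Implicit Types (p q u v w x y z : 'rV[R]_2) (a b c s t : R).
Hypothesis S0 : S !=set0.
Local Notation d := (dist_to S).

Lemma dist_le x y : S y -> d x <= enorm (x - y).
Proof.
move=> Sy; apply: ge_inf; last by exists y.
by exists 0 => _ [z _ <-]; exact: enorm_ge0.
Qed.

Lemma dist_ge x a : (forall y, S y -> a <= enorm (x - y)) -> a <= d x.
Proof.
move=> h; apply: lb_le_inf; last by move=> _ [z Sz <-]; exact: h.
by have [y Sy] := S0; exists (enorm (x - y)), y.
Qed.

Lemma dist_ge0 x : 0 <= d x.
Proof. by apply: dist_ge => y _; exact: enorm_ge0. Qed.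

Lemma dist_leD x y : d x <= d y + enorm (x - y).
Proof.
rewrite -lerBlDr; apply: dist_ge => z Sz; rewrite lerBlDr addrC.
exact: le_trans (dist_le x z Sz) (enorm_triangle _ _ _).
Qed.

Lemma dist_lip x y : `|d x - d y| <= 1 * enorm (x - y).
Proof.
rewrite mul1r ler_norml; have := dist_leD x y; have := dist_leD y x.
by rewrite (enormB y x) => h1 h2; apply/andP; split; lra.
Qed.

Hypothesis clS : closed S.

Lemma projection x : exists2 q, S q & enorm (x - q) = d x.
Proof.
have [y0 Sy0] := S0.
pose K := S `&` [set y | enorm (x - y) <= enorm (x - y0)].
have clK : closed K by apply: closedI => //; exact: closed_eball.
have bK y : K y -> enorm y <= enorm x + enorm (x - y0).
  move=> [_ /= hy]; rewrite -[y](subKr x); apply: le_trans (enormD _ _) _.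
  by rewrite enormN lerD2l.
have Ky0 : K y0 by split=> /=.
have K0 : K !=set0 by exists y0.
have [q [Sq _] hq] := lip_min K _ _ _ clK K0 bK (enorm_lip x).
exists q => //; apply/eqP; rewrite eq_le dist_le // andbT.
apply: dist_ge => y Sy; have [hy|hy] := leP (enorm (x - y)) (enorm (x - y0)).
  by apply: hq.
exact: le_trans (hq y0 Ky0) (ltW hy).
Qed.

Lemma dist_gt0 x : ~ S x -> 0 < d x.
Proof.
move=> Sx; rewrite lt0r dist_ge0 andbT; apply/eqP => d0; apply: Sx.
have [q Sq] := projection x; rewrite d0 => /enorm_eq0/subr0_eq -> //.
Qed.

(** With [w] the unit vector from [q] to [x], [enorm G <= 1] and [1 <= dot G w] force [G = w]. Since
    [grad d x] does not depend on [q], the nearest point of [S] is unique wherever [d] is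
    differentiable. *)
Lemma grad_dist x q : differentiable (d : 'rV[R]_2 -> R) x -> 0 < d x -> S q ->
  enorm (x - q) = d x ->
  [/\ dot (grad d x) (grad d x) = 1 & x = q + d x *: grad d x].
Proof.
move=> dd d0 Sq xq; set G := grad d x.
pose w := (d x)^-1 *: (x - q).
have wE : d x *: w = x - q by rewrite /w scalerA divff ?gt_eqF // scale1r.
have w1 : dot w w = 1.
  by rewrite /w dotZl dotZr -enorm_sqr xq; field; rewrite gt_eqF.
have nw := enorm1 _ w1.
(* [d] is 1-Lipschitz, so the gradient has norm at most 1 ... *)
have G1 : enorm G <= 1.
  have [->|G0] := eqVneq G 0; first by rewrite enorm0.
  have gG := enorm_gt0 _ G0.
  apply/ler_addgt0Pl => e e0; have [del del0 h] := diff_expansion _ _ dd e e0.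
  pose s := del / 2 / enorm G.
  have s0 : 0 < s by rewrite !divr_gt0.
  have nz : enorm (s *: G) = s * enorm G by rewrite enormZ gtr0_norm.
  have : enorm (s *: G) < del by rewrite nz /s divfK ?gt_eqF //; lra.
  move/h; rewrite ler_norml dotZr -/G -enorm_sqr nz => /andP[h1 _].
  have := dist_leD (x + s *: G) x; rewrite (addrC x) addrK nz (addrC _ x) => h2.
  have : s * enorm G * enorm G <= s * enorm G * (e + 1).
    by move: h1 h2; rewrite expr2; lra.
  by rewrite (ler_pM2l (mulr_gt0 s0 gG)).
(* ... while it decreases at unit speed towards the projection. *)
have Gw : 1 <= dot G w.
  apply/ler_addgt0Pl => e e0; have [del del0 h] := diff_expansion _ _ dd e e0.
  pose s := Num.min (del / 2) (d x).
  have s0 : 0 < s by rewrite lt_min d0 divr_gt0.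
  have sd : s <= d x by rewrite ge_min lexx orbT.
  have sdel : s < del.
    by apply: le_lt_trans (_ : del / 2 < del); [rewrite ge_min lexx|lra].
  have nz : enorm (- s *: w) = s by rewrite enormZ nw mulr1 normrN gtr0_norm.
  have : enorm (- s *: w) < del by rewrite nz.
  move/h; rewrite ler_norml dotZr -/G nz => /andP[h1 _].
  have : d (x + - s *: w) <= d x - s.
    apply: le_trans (dist_le _ _ Sq) _.
    have -> : x + - s *: w - q = (d x - s) *: w.
      by rewrite addrAC -wE scalerDl.
    by rewrite enormZ nw mulr1 ger0_norm // subr_ge0.
  move=> h2; have : s * 1 <= s * (e + dot G w) by lra.
  by rewrite ler_pM2l.
have GG : dot G G <= 1 by have := dot_le_enorm _ _ G1; rewrite expr1n.
have Gew : G = w.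
  apply/subr0_eq/dot_eq0/eqP; rewrite eq_le dot_ge0 andbT.
  by rewrite dotBl !dotBr (dotC w G) w1; lra.
by rewrite Gew; split=> //; rewrite wE addrC subrK.
Qed.

End Distance.

(** * Normals, and why the gradient of the distance is one *)

Section Normals.
Context {R : realType} {S : set 'rV[R]_2}.
Implicit Types (p q u v w x y z : 'rV[R]_2) (a b c s t : R).
Hypothesis S0 : S !=set0.
Hypothesis clS : closed S.
Local Notation d := (dist_to S).

(** Squaring the condition that each [y] in [S] is at distance at least [r] from [q + r *: v] gives
    this inequality. It is linear in [v], which is what makes nonnegative combinations of normals
    tractable. *)
Definition normal (r : R) q v : Prop :=
  [/\ S q, dot v v = 1 &
      forall y, S y -> 2 * r * dot (y - q) v <= dot (y - q) (y - q)].

Lemma normal_ball r q v : 0 < r -> S q -> dot v v = 1 ->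
  r <= d (q + r *: v) -> normal r q v.
Proof.
move=> r0 Sq v1 h; split=> // y Sy.
have : r ^+ 2 <= dot (q + r *: v - y) (q + r *: v - y).
  rewrite -enorm_sqr ler_pXn2r ?nnegrE ?enorm_ge0 ?(ltW r0) //.
  exact: le_trans h (dist_le _ _ Sy).
have -> : q + r *: v - y = r *: v - (y - q) by rewrite opprB [RHS]addrCA addrA.
move: (y - q) => z; rewrite dotBB dotZZ dotZl v1 (dotC v z); lra.
Qed.

(** The ball of radius [t] about [q + t *: v] lies inside the one of radius [r] about [q + r *: v]
    and has [q] on its boundary. *)
Lemma normal_dist r q v t : normal r q v -> 0 <= t -> t <= r ->
  d (q + t *: v) = t.
Proof.
move=> [Sq v1 h] t0 tr; apply/eqP; rewrite eq_le; apply/andP; split.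
  apply: le_trans (dist_le _ _ Sq) _.
  by rewrite (addrC q) addrK enormZ enorm1 // mulr1 ger0_norm.
apply: (dist_ge S0) => y Sy; apply: enorm_ge => //.
have -> : q + t *: v - y = t *: v - (y - q) by rewrite opprB [RHS]addrCA addrA.
have := h y Sy; have := dot_ge0 (y - q); move: (y - q) => z z0 hz.
rewrite dotBB dotZZ dotZl v1 (dotC v z).
have [c0|c0] := leP (dot z v) 0; first by nra.
have : t * dot z v <= r * dot z v by rewrite ler_wpM2r // ltW.
by nra.
Qed.

Context {r : R}.
Hypothesis r0 : 0 < r.
Hypothesis diffd : forall x, 0 < d x <= r -> differentiable (d : 'rV[R]_2 -> R) x.

(** The point [y] minimises [l * enorm (y - x) - d y] on the ball of radius [e]. It must lie on the
    boundary: at an interior point a short step along the unit gradient of [d] gains more than the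
    [l < 1] that it costs. *)
Lemma ascent x (e l : R) : 0 < d x -> 0 <= e -> d x + e <= r -> 0 <= l < 1 ->
  exists2 y, enorm (y - x) <= e & d x + l * e <= d y.
Proof.
move=> x0 e0 xe /andP[l0 l1].
pose f y := l * enorm (y - x) - d y.
have lf y z : `|f y - f z| <= 2 * enorm (y - z).
  have h1 := enorm_triangle y z x; have h2 := enorm_triangle z y x.
  have := dist_lip S0 y z; rewrite mul1r !ler_norml => /andP[h3 h4].
  rewrite (enormB z y) in h2; rewrite /f; apply/andP.
  by have := enorm_ge0 (y - z); split; nra.
pose K := [set y | enorm (y - x) <= e].
have clK : closed K by rewrite /K; under eq_set do rewrite enormB; exact: closed_eball.
have Kx : K x by rewrite /K /= subrr enorm0.
have bK y : K y -> enorm y <= enorm x + e.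
  by move=> Ky; rewrite -(subrK x y) addrC; apply: le_trans (enormD _ _) _; rewrite lerD2l.
have [y Ky hy] := lip_min K f _ _ clK (ex_intro _ x Kx) bK lf.
exists y => //; have := hy x Kx; rewrite /f subrr enorm0 mulr0 sub0r => hyx.
have ly : 0 <= l * enorm (y - x) by rewrite mulr_ge0 ?enorm_ge0.
have [ye|ye] := leP e (enorm (y - x)).
  by have : l * e <= l * enorm (y - x); [rewrite ler_wpM2l|lra].
exfalso.
have y0 : 0 < d y by lra.
have yr : d y <= r by have := dist_leD S0 y x; lra.
have dy : differentiable (d : 'rV[R]_2 -> R) y by apply: diffd; rewrite y0.
have [q Sq yq] := projection S0 clS y.
have [G1 _] := grad_dist S0 _ _ dy y0 Sq yq.
(* Half of the gap between the slopes 1 and [l], left for the error of the first-order expansion. *)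
have e1 : 0 < (1 - l) / 2 by lra.
have [del del0 h] := diff_expansion _ _ dy _ e1.
have [s s0 [sdel se]] : exists2 s, 0 < s & s < del /\ s <= e - enorm (y - x).
  exists (Num.min (del / 2) (e - enorm (y - x))).
    by rewrite lt_min; apply/andP; split; lra.
  split; last by rewrite ge_min lexx orbT.
  by apply: le_lt_trans (_ : del / 2 < del); [rewrite ge_min lexx|lra].
have nz : enorm (s *: grad d y) = s by rewrite enormZ enorm1 // mulr1 gtr0_norm.
have := h (s *: grad d y); rewrite nz => /(_ sdel).
rewrite dotZr G1 ler_norml => /andP[h1 _].
have h2 : enorm (y + s *: grad d y - x) <= enorm (y - x) + s.
  by rewrite addrAC; apply: le_trans (enormD _ _) _; rewrite nz.
have := hy (y + s *: grad d y); rewrite /K /f /=.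
have h3 : enorm (y + s *: grad d y - x) <= e by lra.
move=> /(_ h3) h4.
have : l * enorm (y + s *: grad d y - x) <= l * (enorm (y - x) + s).
  by rewrite ler_wpM2l.
have := mulr_gt0 s0 e1; rewrite mulr1 in h1; lra.
Qed.

(** Let [y] maximise [d] on the ball of radius [e = r - d x] about [x]. By [ascent] with [l] close
    to 1, [d y] is at least [r]. As [y] is at distance at most [d x + e = r] from [q], the triangle
    inequality is an equality, so [y] is [q + r *: v] and its distance to [S] is at least [r]. *)
Lemma normal_grad x q : 0 < d x <= r -> S q -> enorm (x - q) = d x ->
  normal r q (grad d x).
Proof.
move=> /[dup] x0r /andP[x0 xr] Sq xq.
have [G1 xE] := grad_dist S0 _ _ (diffd _ x0r) x0 Sq xq.
move: (grad d x) G1 xE => v G1 xE; pose e := r - d x.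
have e0 : 0 <= e by rewrite /e; lra.
have xe : d x + e <= r by rewrite /e; lra.
pose K := [set y | enorm (y - x) <= e].
have clK : closed K by rewrite /K; under eq_set do rewrite enormB; exact: closed_eball.
have Kx : K x by rewrite /K /= subrr enorm0.
have bK y : K y -> enorm y <= enorm x + e.
  by move=> Ky; rewrite -(subrK x y) addrC; apply: le_trans (enormD _ _) _; rewrite lerD2l.
have lf y z : `|- d y - - d z| <= 1 * enorm (y - z).
  have := dist_lip S0 y z; rewrite !ler_norml => /andP[h1 h2].
  by apply/andP; split; lra.
have [y Ky hy] := lip_min K (fun y => - d y) _ _ clK (ex_intro _ x Kx) bK lf.
have yr : r <= d y.
  apply/ler_addgt0Pl => c c0.
  (* This slope is below 1 even when [e] is 0, and falls short of the full ascent [e] by at most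
     [c]. *)
  have l01 : 0 <= e / (c + e) < 1.
    by rewrite divr_ge0 ?ltr_pdivrMr ?mul1r //; lra.
  have [z Kz hz] := ascent x e (e / (c + e)) x0 e0 xe l01.
  have := hy z Kz; rewrite lerN2 => zy.
  have : e <= e / (c + e) * e + c.
    rewrite -subr_ge0 (_ : _ - e = c ^+ 2 / (c + e)); last by field; lra.
    by rewrite divr_ge0 ?sqr_ge0 //; lra.
  by rewrite /e in hz *; lra.
have yE : y = q + r *: v.
  have dE : x - q = d x *: v by rewrite {1}xE addrC addKr.
  have yq : y - q = (y - x) + d x *: v by rewrite -dE addrA subrK.
  have : r <= enorm (y - q) by exact: le_trans yr (dist_le _ _ Sq).
  move=> /(fun h => le_trans h (lexx _)) h.
  have {h} : r ^+ 2 <= dot (y - q) (y - q).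
    by rewrite -enorm_sqr ler_pXn2r ?nnegrE ?enorm_ge0 // ltW.
  have [z zE] : exists z, z = y - x by exists (y - x).
  rewrite yq -zE; have := dot_le_enorm (y - x) e Ky; rewrite -zE => zz.
  rewrite dotDD dotZr dotZZ G1 => hr.
  have rE : r = d x + e by rewrite /e; lra.
  have zv : e <= dot z v.
    have : d x * e <= d x * dot z v by rewrite rE in hr; nra.
    by rewrite ler_pM2l.
  have : z - e *: v = 0.
    apply/dot_eq0/eqP; rewrite eq_le dot_ge0 andbT.
    rewrite dotBB dotZr dotZZ G1.
    have : e * e <= e * dot z v by rewrite ler_wpM2l.
    by move: zz; lra.
  move/subr0_eq => zv'; apply/(addIr (- q)); rewrite yq -zE zv' rE [in RHS]addrC addKr.
  by rewrite -scalerDl addrC.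
apply: normal_ball => //; by rewrite -yE.
Qed.

End Normals.

(** * Convexity of the cone of normals, and normals in every half-plane *)

Section NormalCone.
Context {R : realType} {S : set 'rV[R]_2} {r : R}.
Implicit Types (p q u v w x y z : 'rV[R]_2) (a b c s t : R).
Hypothesis S0 : S !=set0.
Hypothesis clS : closed S.
Hypothesis r0 : 0 < r.
Local Notation d := (dist_to S).
Local Notation nor := (normal (S := S) r).
Hypothesis diffd : forall x, 0 < d x <= r -> differentiable (d : 'rV[R]_2 -> R) x.

Lemma normal_gradE rho q v t : normal rho q v (S := S) -> 0 < t -> t <= rho -> t <= r ->
  grad d (q + t *: v) = v.
Proof.
move=> nv t0 trho tr; have [Sq v1 _] := nv.
have dE := normal_dist S0 _ _ _ _ nv (ltW t0) trho.
have d0 : 0 < d (q + t *: v) by rewrite dE.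
have xq : enorm (q + t *: v - q) = d (q + t *: v).
  by rewrite dE (addrC q) addrK enormZ enorm1 // mulr1 gtr0_norm.
have dd : differentiable (d : 'rV[R]_2 -> R) (q + t *: v).
  by apply: diffd; rewrite d0 dE.
have [_ /addrI] := grad_dist S0 _ _ dd d0 Sq xq.
by rewrite dE => /(scalerI (lt0r_neq0 t0)) <-.
Qed.

(** Near [q] the vector [v] is the gradient of [d] at [q + t *: v], and gradients are normals of the
    full radius; so any positive radius is as good as [r]. *)
Lemma normal_small rho q v : 0 < rho -> normal rho q v (S := S) -> nor q v.
Proof.
move=> rho0 nv; have [Sq v1 _] := nv.
pose t := Num.min rho r.
have t0 : 0 < t by rewrite lt_min rho0.
have trho : t <= rho by rewrite ge_min lexx.
have tr : t <= r by rewrite ge_min lexx orbT.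
have dE := normal_dist S0 _ _ _ _ nv (ltW t0) trho.
rewrite -(normal_gradE _ _ _ _ nv t0 trho tr).
apply: (normal_grad S0 clS r0 diffd) => //; first by rewrite dE t0.
by rewrite dE (addrC q) addrK enormZ enorm1 // mulr1 gtr0_norm.
Qed.

(** Adding multiples of the two defining inequalities makes the combination a normal of a smaller
    radius, which [normal_small] restores to [r]. *)
Lemma normal_conv q u v a b : nor q u -> nor q v -> 0 <= a -> 0 <= b ->
  dot (a *: u + b *: v) (a *: u + b *: v) = 1 -> nor q (a *: u + b *: v).
Proof.
move=> [Sq _ hu] [_ _ hv] a0 b0 w1.
(* The summand 1 keeps the denominator positive at once and only shrinks the radius further. *)
have ab : 0 < a + b + 1 by lra.
apply: (normal_small (r / (a + b + 1))); first by rewrite divr_gt0.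
split=> // y Sy; have zz := dot_ge0 (y - q).
have hu' := hu y Sy; have hv' := hv y Sy.
rewrite (dotDr (a *: u)) !dotZr; move: (dot (y - q) u) (dot (y - q) v) zz hu' hv' => X Y.
move: (dot _ _) => Z Z0 hX hY.
rewrite (_ : _ * _ = (a * (2 * r * X) + b * (2 * r * Y)) / (a + b + 1));
  last by field; lra.
rewrite ler_pdivrMr //.
have := ler_wpM2l a0 hX; have := ler_wpM2l b0 hY; lra.
Qed.

Hypothesis intS : interior S = set0.

Lemma complement_near x (e : R) : 0 < e -> exists2 y, ~ S y & enorm (y - x) < e.
Proof.
move=> e0; apply: contrapT => h; have : interior S x; last by rewrite intS.
apply/nbhs_enormP; exists e => // y hy; apply: contrapT => Sy; apply: h.
by exists y.
Qed.

(* Otherwise a small ball around [q - s *: w] would be contained in [S]. *)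
Lemma normal_halfplane q w : S q -> dot w w = 1 ->
  exists2 v, nor q v & dot v w <= 0.
Proof.
move=> Sq w1; have nw := enorm1 _ w1.
(* [f v <= 0] says both that [v] is normal at [q] and that [dot v w <= 0]. Minimising over the
   circle lets approximate solutions, found as normals at points near [q], suffice. *)
pose f v := Num.max (dot v w) (r - d (q + r *: v)).
have lf u v : `|f u - f v| <= (1 + r) * enorm (u - v).
  have h1 := dot_abs_le (u - v) w; rewrite nw mulr1 dotBl in h1.
  have h2 := dist_lip S0 (q + r *: u) (q + r *: v).
  have e2 : enorm (q + r *: u - (q + r *: v)) = r * enorm (u - v).
    by rewrite opprD addrACA subrr add0r -scalerBr enormZ gtr0_norm.
  rewrite e2 mul1r in h2; move: h1 h2; rewrite /f.
  move: (dot u w) (dot v w) (d _) (d _) => A B C D.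
  have := enorm_ge0 (u - v); move: (enorm _) => E E0.
  rewrite !ler_norml => /andP[h1 h2] /andP[h3 h4].
  have rE : 0 <= r * E by rewrite mulr_ge0 // ltW.
  by apply/andP; split; rewrite !maxEle; do 2!case: ifP => ?; lra.
pose K := [set v : 'rV[R]_2 | dot v v = 1].
have clK : closed K by exact: closed_circle.
have bK v : K v -> enorm v <= 1 by move=> /enorm1 ->.
have [v Kv hv] := lip_min K f _ _ clK (ex_intro _ w w1) bK lf.
suff fv : f v <= 0.
  have : dot v w <= 0 /\ r - d (q + r *: v) <= 0.
    by move: fv; rewrite /f ge_max => /andP.
  move=> [vw hr]; exists v => //; apply: normal_ball => //; lra.
apply/ler_addgt0Pl => m m0; rewrite addr0.
(* A point [x] off [S] is taken within [s ^+ 2] of [q - s *: w], and [u] is its gradient, normal at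
   its projection [q']. Then [q'] is within [4 * s] of [q], normality gives
   [r * dot (q - q') u <= 8 * s ^+ 2], and dividing by [s] leaves [r * dot u w <= (r + 8) * s]. *)
have [s [s0 s1 sr sm smr]] : exists s, [/\ 0 < s, s <= 1, 2 * s <= r, 4 * s <= m
    & (r + 8) * s <= r * m].
  pose s := Num.min (Num.min 1 (r / 2)) (Num.min (m / 4) (r * m / (r + 8))).
  have s0 : 0 < s.
    by rewrite !lt_min ltr01 !divr_gt0 ?mulr_gt0 // addr_gt0.
  have [s1 s2] : s <= Num.min 1 (r / 2) /\ s <= Num.min (m / 4) (r * m / (r + 8)).
    by split; rewrite /s ge_min lexx ?orbT.
  move: s1 s2; rewrite !le_min => /andP[h1 h2] /andP[h3 h4].
  exists s; split=> //; try lra.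
  by move: h4; rewrite ler_pdivlMr ?addr_gt0 // mulrC.
have [x Sx hx] := complement_near (q - s *: w) (s ^+ 2) (exprn_gt0 2 s0).
have xq : enorm (x - q) <= 2 * s.
  have -> : x - q = (x - (q - s *: w)) + - s *: w.
    by rewrite opprB addrA scaleNr addrAC addrK.
  apply: le_trans (enormD _ _) _; rewrite enormZ nw normrN gtr0_norm // mulr1.
  by have : s ^+ 2 <= s * 1; [rewrite expr2 ler_wpM2l // ltW|lra].
have x0 := dist_gt0 S0 clS x Sx.
have dx : d x <= 2 * s by exact: le_trans (dist_le _ _ Sq) xq.
have [q' Sq' xq'] := projection S0 clS x.
have x0r : 0 < d x <= r by rewrite x0 /=; lra.
have ng := normal_grad S0 clS r0 diffd _ _ x0r Sq' xq'.
have [_ xE] := grad_dist S0 _ _ (diffd _ x0r) x0 Sq' xq'.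
move: (grad d x) ng xE => u nu xE; have [_ u1 hu] := nu.
apply: le_trans (hv u u1) _.
have qq' : enorm (q - q') <= 4 * s.
  apply: le_trans (enorm_triangle q x q') _; rewrite xq' enormB; lra.
rewrite /f ge_max; apply/andP; split; last first.
  have := dist_leD S0 (q' + r *: u) (q + r *: u).
  rewrite (normal_dist S0 _ _ _ _ nu (ltW r0) (lexx r)).
  by rewrite opprD addrACA subrr addr0 enormB; lra.
have h := hu q Sq; have h16 := dot_le_enorm _ _ qq'.
have e1 := dot_abs_le (x - (q - s *: w)) u.
rewrite (enorm1 _ u1) mulr1 in e1.
have {e1} := le_trans e1 (ltW hx); rewrite ler_norml => /andP[e1 e2].
have eE : dot (x - (q - s *: w)) u = d x + s * dot u w - dot (q - q') u.
  by rewrite {1}xE !dotBl dotDl !dotZl u1 (dotC w); ring.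
rewrite eE in e2.
have h2 : r * (s * dot u w) <= r * (s ^+ 2 + dot (q - q') u).
  by rewrite ler_pM2l //; lra.
have : s * (r * dot u w) <= s * (r * m); last by rewrite !ler_pM2l.
have : s * ((r + 8) * s) <= s * (r * m) by rewrite ler_pM2l.
lra.
Qed.

End NormalCone.

(** * Antipodal pairs of normals, and what further normals imply *)

Section Antipodal.
Context {R : realType} {S : set 'rV[R]_2} {r : R}.
Implicit Types (p q u v w x y z : 'rV[R]_2) (a b c s t : R).
Hypothesis S0 : S !=set0.
Hypothesis clS : closed S.
Hypothesis r0 : 0 < r.
Local Notation d := (dist_to S).
Local Notation nor := (normal (S := S) r).
Hypothesis diffd : forall x, 0 < d x <= r -> differentiable (d : 'rV[R]_2 -> R) x.
Hypothesis intS : interior S = set0.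

Lemma closed_normal q : S q -> closed [set v | nor q v].
Proof.
move=> Sq.
have -> : [set v | nor q v] = [set v | dot v v = 1] `&`
    (fun v => d (q + r *: v)) @^-1` [set a | r <= a].
  apply/seteqP; split=> v /=.
    move=> nv; have [_ v1 _] := nv; split=> //=.
    by rewrite (normal_dist S0 _ _ _ _ nv (ltW r0) (lexx r)).
  by move=> [v1 h]; apply: normal_ball.
apply: closedI; first exact: closed_circle.
apply: preimage_closed; last exact: closed_ge.
move=> v _; apply: (lip_continuous _ r) => {}v u.
apply: le_trans (dist_lip S0 _ _) _; rewrite mul1r.
by rewrite opprD addrACA subrr add0r -scalerBr enormZ gtr0_norm.
Qed.

(** Take normals [u], [v] at the widest angle. If they are not opposite, there is a normal [z] with
    [dot z (u + v) <= 0]. Its angles with [u] and [v] are no wider than that between [u] and [v], so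
    by [cos_obtuse] the vector [- z] lies in the cone spanned by [u] and [v], and convexity makes it
    normal. *)
Lemma antipodal q : S q -> exists2 v, nor q v & nor q (- v).
Proof.
move=> Sq; pose K := [set v | nor q v]; have clK : closed K by exact: closed_normal.
have bK v : K v -> enorm v <= 1 by move=> [_ /enorm1 -> _].
have K0 : K !=set0.
  have [z _ /eqP] : exists2 z : 'rV[R]_2, True & dot z z == 1.
    by exists (delta_mx ord0 ord0) => //; apply/eqP; rewrite /dot !mxE /=; ring.
  by move=> /(normal_halfplane S0 clS r0 diffd intS _ _ Sq)[v nv _]; exists v.
have m_ex u : exists v, K v /\ forall z, K z -> dot u v <= dot u z.
  have lf y z : `|dot u y - dot u z| <= enorm u * enorm (y - z).
    by rewrite -dotBr dot_abs_le.
  by have [v Kv hv] := lip_min K (dot u) _ _ clK K0 bK lf; exists v.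
have [m hm] := choice m_ex.
(* A minimum of linear functions given by unit vectors is 1-Lipschitz; this permits minimising over
   pairs one variable at a time. *)
have lF u u' : `|dot u (m u) - dot u' (m u')| <= 1 * enorm (u - u').
  have [[_ mu1 _] hu] := hm u; have [[_ mu1' _] hu'] := hm u'.
  have := hu _ (hm u').1; have := hu' _ (hm u).1.
  have := dot_abs_le (u - u') (m u); have := dot_abs_le (u - u') (m u').
  rewrite (enorm1 _ mu1) (enorm1 _ mu1') !mulr1 mul1r !dotBl !ler_norml.
  by move=> /andP[h1 h2] /andP[h3 h4] h5 h6; apply/andP; split; lra.
have [u Ku hu] := lip_min K (fun u => dot u (m u)) _ _ clK K0 bK lF.
have [Kv hv] := hm u; move: (m u) Kv hv hu => v Kv hv hu.
have {hu}minc y z : K y -> K z -> dot u v <= dot y z.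
  by move=> Ky Kz; apply: le_trans (hu _ Ky) ((hm y).2 _ Kz).
have [_ u1 _] := Ku; have [_ v1 _] := Kv.
have c1 : - 1 <= dot u v.
  have := dot_abs_le u v; rewrite !enorm1 // mulr1 ler_norml.
  by move=> /andP[].
move: c1; rewrite le_eqVlt => /orP[/eqP c1|c1].
  by exists u => //; rewrite -(unit_anti _ _ u1 v1 (esym c1)).
have w0 : u + v != 0.
  apply/eqP => uv0; have := dotDD u v; rewrite uv0 dot0l u1 v1; lra.
have [z nz] := normal_halfplane S0 clS r0 diffd intS _ _ Sq (enorm_unit _ w0).
rewrite dotZr pmulr_rle0 ?invr_gt0 ?enorm_gt0 // dotDr => zw.
have hzu := minc z u nz Ku; have hzv := minc z v nz Kv.
have c0 : dot u v <= 0 by lra.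
have [_ z1 _] := nz; have g := gram _ _ _ u1 v1 z1.
have a0 : dot z u <= dot u v * dot z v by exact: cos_obtuse g.
have b0 : dot z v <= dot u v * dot z u.
  by apply: (cos_obtuse (dot u v)) => //; [lra|move: g; lra].
have D : 0 < 1 - dot u v ^+ 2.
  rewrite (_ : _ - _ = (1 + dot u v) * (1 - dot u v)); last by ring.
  by rewrite mulr_gt0; lra.
(* Cramer's rule; the two numerators are nonnegative by [a0] and [b0]. *)
have zE : - z = ((dot u v * dot z v - dot z u) / (1 - dot u v ^+ 2)) *: u +
              ((dot u v * dot z u - dot z v) / (1 - dot u v ^+ 2)) *: v.
  apply/subr0_eq; apply: (dot_orth0 u v).
  - rewrite dotBl dotDl !dotZl dotNl (dotC v u) u1; field; lra.
  - rewrite dotBl dotDl !dotZl dotNl v1; field; lra.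
  - by rewrite u1 v1 mulr1; lra.
exists z => //; rewrite zE; apply: (normal_conv S0 clS r0 diffd) => //.
- by rewrite divr_ge0 ?(ltW D) //; lra.
- by rewrite divr_ge0 ?(ltW D) //; lra.
- by rewrite -zE dotNl dotNr opprK.
Qed.

(* The ball of radius [2 * r] around [p] contains no other point of [S]. *)
Lemma normal_all_set1 p : (forall v, dot v v = 1 -> nor p v) -> S p -> connected S ->
  S = [set p].
Proof.
move=> hp Sp cS.
have far y : S y -> enorm (y - p) < 2 * r -> y = p.
  move=> Sy yp; apply/eqP; apply: contraT => ynp.
  have yp0 : y - p != 0 by rewrite subr_eq0.
  have [_ _ h] := hp _ (enorm_unit _ yp0).
  have := h y Sy; rewrite dotZr -enorm_sqr.
  have e0 := enorm_gt0 _ yp0.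
  have -> : (enorm (y - p))^-1 * enorm (y - p) ^+ 2 = enorm (y - p).
    by field; rewrite gt_eqF.
  by rewrite expr2 ler_pM2r // leNgt yp.
symmetry; apply: cS; first by exists p.
- exists [set y | enorm (y - p) < 2 * r]; last first.
    apply/seteqP; split=> y /=; last by move=> [Sy]; exact: far.
    by move=> ->; rewrite subrr enorm0; split=> //; apply: mulr_gt0.
  rewrite openE => y /= hy; rewrite /interior; apply/nbhs_enormP.
  exists (2 * r - enorm (y - p)) => [|z hz /=]; first by lra.
  by apply: le_lt_trans (enorm_triangle z y p) _; lra.
- exists [set p]; first exact/accessible_closed_set1/hausdorff_accessible/norm_hausdorff.
  by apply/seteqP; split=> y /=; [move=> ->|move=> []].
Qed.

Lemma normal_orth p u z e : nor p u -> nor p (- u) -> nor p z ->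
  dot e e = 1 -> dot u e = 0 -> 0 < dot z e -> nor p e.
Proof.
move=> nu nu' nz e1 ue ze; have [_ u1 _] := nu.
have zE := orth_decomp u e z u1 e1 ue.
have eE : e = (dot z e)^-1 *: z + (- (dot z u) / dot z e) *: u.
  rewrite {2}zE scalerDr !scalerA mulVf ?gt_eqF // scale1r addrAC.
  by rewrite -scalerDl mulNr (mulrC (dot z u)) subrr scale0r add0r.
have z0 := ltW ze; have [h|h] := leP (dot z u) 0.
  rewrite eE; apply: (normal_conv S0 clS r0 diffd) => //; last by rewrite -eE.
    by rewrite invr_ge0.
  by rewrite divr_ge0 // oppr_ge0.
rewrite mulNr scaleNr -scalerN in eE.
rewrite eE; apply: (normal_conv S0 clS r0 diffd) => //; last by rewrite -eE.
  by rewrite invr_ge0.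
by rewrite divr_ge0 // ltW.
Qed.

Lemma normal_half p u z : nor p u -> nor p (- u) -> nor p z -> z <> u ->
  z <> - u -> exists e, [/\ dot e e = 1, dot u e = 0 & nor p e].
Proof.
move=> nu nu' nz zu zu'; have [_ u1 _] := nu; have [_ z1 _] := nz.
have key e := normal_orth p u z e nu nu' nz.
have pe : dot (perp u) (perp u) = 1 by rewrite perp_unit.
have up : dot u (perp u) = 0 by rewrite dotC dot_perp.
have zE := orth_decomp u (perp u) z u1 pe up.
have [h|h|h] := ltgtP (dot z (perp u)) 0.
- exists (- perp u); rewrite dotNl !dotNr opprK up oppr0; split=> //.
  by apply: key; rewrite ?dotNl ?dotNr ?opprK ?up ?oppr0 ?oppr_gt0.
- by exists (perp u); split=> //; exact: key.
- rewrite h scale0r addr0 in zE; exfalso.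
  have : (dot z u - 1) * (dot z u + 1) = 0.
    by move: z1; rewrite {1 2}zE dotZZ u1; lra.
  move/eqP; rewrite mulf_eq0 subr_eq0 addr_eq0 => /orP[]/eqP h1.
    by apply: zu; rewrite zE h1 scale1r.
  by apply: zu'; rewrite zE h1 scaleN1r.
Qed.

Lemma normal_full p u e v : nor p u -> nor p (- u) -> nor p e -> nor p (- e) ->
  dot u e = 0 -> dot v v = 1 -> nor p v.
Proof.
move=> nu nu' ne ne' ue v1; have [_ u1 _] := nu; have [_ e1 _] := ne.
have vE := orth_decomp u e v u1 e1 ue.
have nc := normal_conv S0 clS r0 diffd.
have [h1|h1] := leP 0 (dot v u); have [h2|h2] := leP 0 (dot v e).
- by rewrite vE; apply: nc; rewrite -?vE.
- rewrite vE -[dot v e *: e]opprK -scaleNr -scalerN; apply: nc => //.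
    by rewrite oppr_ge0 ltW.
  by rewrite scalerN scaleNr opprK -vE.
- rewrite vE -[dot v u *: u]opprK -scaleNr -scalerN; apply: nc => //.
    by rewrite oppr_ge0 ltW.
  by rewrite scalerN scaleNr opprK -vE.
- rewrite vE -[dot v e *: e]opprK -scaleNr -scalerN.
  rewrite -[dot v u *: u]opprK -scaleNr -scalerN; apply: nc => //;
    rewrite ?oppr_ge0 ?ltW //.
  by rewrite !scalerN !scaleNr !opprK -vE.
Qed.

End Antipodal.

(** * Lipschitz dependence of antipodal normals, and the neighbours of a half-circle *)

Section HalfCircle.
Context {R : realType} {S : set 'rV[R]_2} {r : R}.
Implicit Types (p q u v w x y z : 'rV[R]_2) (a b c s t : R).
Hypothesis S0 : S !=set0.
Hypothesis clS : closed S.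
Hypothesis r0 : 0 < r.
Local Notation d := (dist_to S).
Local Notation nor := (normal (S := S) r).
Hypothesis diffd : forall x, 0 < d x <= r -> differentiable (d : 'rV[R]_2 -> R) x.

Lemma normal_chord q q' v : nor q v -> nor q (- v) -> S q' ->
  `|dot (q' - q) v| <= enorm (q' - q) / (2 * r) * enorm (q' - q).
Proof.
move=> [_ _ h1] [_ _ h2] Sq'; have := h1 _ Sq'; have := h2 _ Sq'.
rewrite dotNr -enorm_sqr => h3 h4.
have r2 : 0 < 2 * r by rewrite mulr_gt0.
rewrite (_ : _ * _ = enorm (q' - q) ^+ 2 / (2 * r)); last by field; lra.
have A : dot (q' - q) v <= enorm (q' - q) ^+ 2 / (2 * r).
  by rewrite ler_pdivlMr // mulrC.
have B : - dot (q' - q) v <= enorm (q' - q) ^+ 2 / (2 * r).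
  by rewrite ler_pdivlMr // mulrC.
by rewrite ler_norml A andbT lerNl.
Qed.

(** The chord is almost orthogonal to both normals, with factor [enorm (q - q') / (2 * r)], at most
    1/2 by the bound on the chord; [almost_orth] multiplies this factor by 4. *)
Lemma normal_lip q q' v v' : nor q v -> nor q (- v) -> nor q' v' -> nor q' (- v') ->
  0 <= dot v v' -> q != q' -> enorm (q - q') <= r ->
  enorm (v - v') <= 2 / r * enorm (q - q').
Proof.
move=> nv nvN nv' nvN' vv' qq' hr.
have [Sq v1 _] := nv; have [Sq' v1' _] := nv'.
have r2 : 0 < 2 * r by rewrite mulr_gt0.
have u0 : q - q' != 0 by rewrite subr_eq0.
have h1 := normal_chord _ _ _ nv nvN Sq'; have h2 := normal_chord _ _ _ nv' nvN' Sq.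
rewrite -opprB dotNl normrN enormN in h1.
have -> : 2 / r * enorm (q - q') = 4 * (enorm (q - q') / (2 * r)) by field; lra.
apply: (almost_orth _ (q - q')) => //.
  by rewrite divr_ge0 ?enorm_ge0 // ltW.
by rewrite ler_pdivrMr //; lra.
Qed.

(** If [q] had an unpaired normal, its normals would contain a half-circle with some middle [e'].
    Applied from both ends, [almost_parallel] puts the unit vector from [p] to [q] close to [e'] and
    to [- e]. Then [q + r *: e'], at distance [r] from [S], is close to [p - r *: e], whose distance
    is only [r - m]. *)
Lemma normal_reflected p u e : S p -> nor p u -> nor p (- u) -> nor p e ->
  dot u e = 0 -> ~ nor p (- e) ->
  (forall q, S q -> exists2 v, nor q v & nor q (- v)) ->
  exists2 b, 0 < b & forall q v, q != p -> enorm (q - p) <= b -> nor q v ->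
    nor q (- v).
Proof.
move=> Sp nu nuN ne ue neN anti; have [_ u1 _] := nu; have [_ e1 _] := ne.
pose m := r - d (p + r *: (- e)).
have m0 : 0 < m.
  rewrite subr_gt0 ltNge; apply/negP => h; apply: neN; apply: normal_ball => //.
  by rewrite dotNl dotNr opprK.
(* The first bound keeps [a] below 1/2, the last one puts [w] within [m / (4 * r)] of both [e'] and
   [- e]; with [m / 3] for [q - p], the displacement is at most [m / 3 + m / 2 < m]. *)
exists (Num.min (r / 2) (Num.min (m / 3) (m ^+ 2 / (16 * r)))).
  by rewrite !lt_min !divr_gt0 ?mulr_gt0 ?exprn_gt0.
move=> q v qp; rewrite !le_min => /and3P[h1 h2 h3] nv.
have [Sq v1 _] := nv; have [v' nv' nvN'] := anti q Sq.
apply: contrapT => nvN.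
have vv' : v <> v' by move=> vv'; apply: nvN; rewrite vv'.
have vvN' : v <> - v' by move=> E; apply: nvN; rewrite E opprK.
have [e' [e1' ue' ne']] := normal_half S0 clS r0 diffd _ _ _ nv' nvN' nv vv' vvN'.
have [_ v1' _] := nv'.
have w0 : q - p != 0 by rewrite subr_eq0.
have ew := enorm_gt0 _ w0.
pose a := enorm (q - p) / (2 * r).
have a0 : 0 <= a by rewrite divr_ge0 ?enorm_ge0 // mulr_ge0 // ltW.
have r2 : 0 < 2 * r by rewrite mulr_gt0.
have a2 : a < 1 / 2 by rewrite /a ltr_pdivrMr //; lra.
have [w wE] : exists w, w = (enorm (q - p))^-1 *: (q - p).
  by exists ((enorm (q - p))^-1 *: (q - p)).
have w1 : dot w w = 1 by rewrite wE enorm_unit.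
have hw x : `|dot (q - p) x| <= a * enorm (q - p) -> `|dot w x| <= a.
  by rewrite wE dotZl normrM gtr0_norm ?invr_gt0 // ler_pdivrMl // mulrC.
have hwl x : - (a * enorm (q - p)) <= dot (q - p) x -> - a <= dot w x.
  by rewrite wE dotZl ler_pdivlMl // mulrN mulrC.
have hb q1 q2 x : nor q1 x -> S q2 ->
    dot (q2 - q1) x <= enorm (q2 - q1) / (2 * r) * enorm (q2 - q1).
  move=> [_ _ h] Sq2; have := h _ Sq2; rewrite -enorm_sqr => hh.
  rewrite (_ : _ / _ * _ = enorm (q2 - q1) ^+ 2 / (2 * r)); last by field; lra.
  by rewrite ler_pdivlMr // mulrC.
have eqp : enorm (p - q) = enorm (q - p) by exact: enormB.
have dqp x : dot (p - q) x = - dot (q - p) x by rewrite -opprB dotNl.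
have b1 : dot (w - e') (w - e') <= 2 * a.
  apply: (almost_parallel a w v') => //.
    apply: hw; have := normal_chord _ _ _ nv' nvN' Sp.
    by rewrite dqp normrN eqp.
  by apply: hwl; have := hb _ _ _ ne' Sp; rewrite dqp eqp -/a; lra.
have b2 : dot (- w - e) (- w - e) <= 2 * a.
  apply: (almost_parallel a (- w) u) => //.
  - by rewrite dotNl dotNr opprK.
  - by rewrite dotNl normrN; apply: hw; exact: normal_chord.
  - rewrite dotNl lerN2; have := hb _ _ _ ne Sq; rewrite -/a => h.
    by rewrite wE dotZl ler_pdivrMl // mulrC.
have ee : enorm (e' + e) <= m / (2 * r).
  have h4 : enorm (w - e') ^+ 2 <= (m / (4 * r)) ^+ 2.
    rewrite enorm_sqr; apply: le_trans b1 _.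
    rewrite (_ : 2 * a = enorm (q - p) / r); last by rewrite /a; field; lra.
    rewrite ler_pdivrMr //; move: h3.
    rewrite (_ : (m / (4 * r)) ^+ 2 * r = m ^+ 2 / (16 * r)) //; field; lra.
  have h5 : enorm (- w - e) ^+ 2 <= (m / (4 * r)) ^+ 2.
    rewrite enorm_sqr; apply: le_trans b2 _.
    rewrite (_ : 2 * a = enorm (q - p) / r); last by rewrite /a; field; lra.
    rewrite ler_pdivrMr //; move: h3.
    rewrite (_ : (m / (4 * r)) ^+ 2 * r = m ^+ 2 / (16 * r)) //; field; lra.
  have m4 : 0 <= m / (4 * r) by rewrite divr_ge0 ?(ltW m0) // mulr_ge0 // ltW.
  rewrite !ler_pXn2r ?nnegrE ?enorm_ge0 // in h4 h5.
  have -> : e' + e = - (w - e') + - (- w - e).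
    by rewrite !opprB opprK (addrC e w) addrA subrK.
  apply: le_trans (enormD _ _) _; rewrite !enormN.
  have -> : m / (2 * r) = m / (4 * r) + m / (4 * r) by field; lra.
  exact: lerD.
have dq := normal_dist S0 _ _ _ _ ne' (ltW r0) (lexx r).
have := dist_leD S0 (q + r *: e') (p + r *: (- e)); rewrite dq.
have : enorm (q + r *: e' - (p + r *: - e)) <= enorm (q - p) + m / 2.
  have -> : q + r *: e' - (p + r *: - e) = (q - p) + r *: (e' + e).
    by rewrite opprD addrACA scalerN opprK scalerDr.
  apply: le_trans (enormD _ _) _; rewrite lerD2l enormZ gtr0_norm //.
  by have : r * enorm (e' + e) <= r * (m / (2 * r)); [rewrite ler_pM2l|
    rewrite (_ : r * (m / (2 * r)) = m / 2); [|field; lra]].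
have : r = d (p + r *: - e) + m by rewrite /m addrC subrK.
move: (d _) (enorm (q + _ - _)) => A B; lra.
Qed.

End HalfCircle.

(** * Exclusion of half-circles of normals *)

Section NoHalf.
Context {R : realType} {S : set 'rV[R]_2} {r : R}.
Implicit Types (p q u v w x y z : 'rV[R]_2) (a b c s t h k : R).
Hypothesis S0 : S !=set0.
Hypothesis clS : closed S.
Hypothesis r0 : 0 < r.
Local Notation d := (dist_to S).
Local Notation nor := (normal (S := S) r).
Hypothesis diffd : forall x, 0 < d x <= r -> differentiable (d : 'rV[R]_2 -> R) x.
Hypothesis diffG : forall x, 0 < d x <= r -> forall i : 'I_2,
  differentiable ('D_(delta_mx ord0 i) (d : 'rV[R]_2 -> R)) x.

(* On the side of [e] all points near [p + t *: u] project onto [p]: there the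
   distance is the distance to [p], whose level set is a circle of radius [t]. *)
Lemma hess_sector p u e t : nor p u -> nor p e -> dot u e = 0 -> 0 < t -> t < r ->
  hess d (p + t *: u) e e = t^-1.
Proof.
move=> nu ne ue t0 tr; have [Sp u1 _] := nu; have [_ e1 _] := ne.
have dx := normal_dist S0 _ _ _ _ nu (ltW t0) (ltW tr).
have x0r : 0 < d (p + t *: u) <= r by rewrite dx t0 ltW.
have gx := normal_gradE S0 diffd _ _ _ _ nu t0 (ltW tr) (ltW tr).
set k := hess _ _ _ _.
suff H : forall c, 0 < c -> `|t^-1 - k| <= c.
  apply/esym/subr0_eq/normr0_eq0/eqP; rewrite eq_le normr_ge0 andbT.
  by apply/ler_addgt0Pl => c c0; rewrite addr0; exact: H.
move=> c c0; have c2 : 0 < c / 2 by rewrite divr_gt0.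
have [del del0 exph] := hess_expansion _ _ _ (diffG _ x0r) e1 _ c2.
(* Since [rho - t <= h], the last bound makes the inverses of [t] and [rho] differ by at most
   [c / 2]. *)
have [h [h0 hdel hr ht]] : exists h, [/\ 0 < h, h < del, h <= r - t &
    h <= c / 2 * t ^+ 2].
  have m1 : 0 < r - t by rewrite subr_gt0.
  have m2 : 0 < c / 2 * t ^+ 2 by rewrite mulr_gt0 // exprn_gt0.
  exists (Num.min (del / 2) (Num.min (r - t) (c / 2 * t ^+ 2))); split.
  - by rewrite !lt_min m1 m2 divr_gt0.
  - apply: le_lt_trans (_ : del / 2 < del); first by rewrite ge_min lexx.
    by rewrite ltr_pdivrMr // ltr_pMr // ltr1n.
  - by rewrite !ge_min lexx orbT.
  - by rewrite !ge_min lexx !orbT.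
have he : enorm (h *: e) = h by rewrite enormZ enorm1 // mulr1 gtr0_norm.
have := exph (h *: e); rewrite he => /(_ hdel).
have [rho rhoE] : exists rho, rho = enorm (t *: u + h *: e).
  by exists (enorm (t *: u + h *: e)).
have rho2 : rho ^+ 2 = t ^+ 2 + h ^+ 2.
  by rewrite rhoE enorm_sqr dotDD !dotZZ dotZl dotZr u1 e1 ue; ring.
have rt : t <= rho.
  by rewrite rhoE; apply: enorm_ge; rewrite ?(ltW t0) // -enorm_sqr -rhoE rho2 lerDl sqr_ge0.
have rho0 : 0 < rho by exact: lt_le_trans rt.
have rth : rho <= t + h.
  rewrite rhoE; apply: le_trans (enormD _ _) _.
  by rewrite he enormZ enorm1 // mulr1 gtr0_norm.
have rr : rho <= r by lra.
have vE : t *: u + h *: e = rho *: ((t / rho) *: u + (h / rho) *: e).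
  by rewrite scalerDr !scalerA; congr (_ *: _ + _ *: _); field; rewrite gt_eqF.
have nv : nor p ((t / rho) *: u + (h / rho) *: e).
  apply: (normal_conv S0 clS r0 diffd) => //; rewrite ?divr_ge0 ?ltW //.
  rewrite dotDD !dotZZ dotZl dotZr u1 e1 ue.
  have -> : (t / rho) ^+ 2 * 1 + 2 * (t / rho * (h / rho * 0)) + (h / rho) ^+ 2 * 1
    = (t ^+ 2 + h ^+ 2) / rho ^+ 2 by field; rewrite gt_eqF.
  by rewrite -rho2 divff // gt_eqF // exprn_gt0.
have -> : p + t *: u + h *: e = p + rho *: ((t / rho) *: u + (h / rho) *: e).
  by rewrite -addrA vE.
rewrite (normal_gradE S0 diffd _ _ _ _ nv rho0 rr rr) gx.
rewrite hessZl -/k dotBl dotDl !dotZl e1 ue => hk.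
have e2 : h / rho - h * k = h * (rho^-1 - k) by ring.
have {hk} : h * `|rho^-1 - k| <= h * (c / 2).
  move: hk; rewrite mulr0 add0r mulr1 subr0 e2 normrM (gtr0_norm h0).
  by rewrite (mulrC h (c / 2)).
rewrite ler_pM2l // => hk.
have h3 : `|t^-1 - rho^-1| <= c / 2.
  have -> : t^-1 - rho^-1 = (rho - t) / (t * rho) by field; rewrite !gt_eqF.
  rewrite ger0_norm; last by rewrite divr_ge0 ?mulr_ge0 ?subr_ge0 // ltW.
  rewrite ler_pdivrMr ?mulr_gt0 //.
  have : c / 2 * (t * t) <= c / 2 * (t * rho) by rewrite !ler_pM2l.
  by move: ht; rewrite expr2; lra.
have -> : t^-1 - k = (t^-1 - rho^-1) + (rho^-1 - k) by rewrite addrA subrK.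
by apply: le_trans (ler_normD _ _) _; lra.
Qed.

(** From [p + t *: u] a step [h] is taken away from [e]. By [hess_sector] the gradient turns by
    about [h / t] along [e], which cancels the step, so the projection [q] moves from [p] by a small
    fraction of [h] only. The normals at [p] and [q] are then too different for [normal_lip]. *)
Lemma normal_pair_full p u e :
  (forall q, S q -> exists2 v, nor q v & nor q (- v)) ->
  nor p u -> nor p (- u) -> nor p e -> dot u e = 0 -> nor p (- e).
Proof.
move=> anti nu nuN ne ue; apply: contrapT => neN.
have [Sp u1 _] := nu; have [_ e1 _] := ne.
have [b b0 refl] := normal_reflected S0 clS r0 diffd _ _ _ Sp nu nuN ne ue neN anti.
pose t := r / 2; have t0 : 0 < t by rewrite divr_gt0.
have tr : t < r by have := r0; rewrite /t; lra.
have rE : r = 2 * t by rewrite /t; field.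
have dx := normal_dist S0 _ _ _ _ nu (ltW t0) (ltW tr).
have x0r : 0 < d (p + t *: u) <= r by rewrite dx t0 ltW.
have gx := normal_gradE S0 diffd _ _ _ _ nu t0 (ltW tr) (ltW tr).
have kE := hess_sector _ _ _ _ nu ne ue t0 tr.
(* The inverse of [t] is [18 * c]: the gradient turns by at least [17 * (c * h)], whereas the
   Lipschitz bound allows [8 * (c * h)]. *)
pose c := (9 * r)^-1; have c0 : 0 < c by rewrite invr_gt0 mulr_gt0.
have [del1 del10 exph] := hess_expansion _ _ _ (diffG _ x0r) e1 _ c0.
(* [eta <= 1] makes [dot u v] nonnegative; [t * eta <= B / 2] and [2 * h <= B / 2] keep [q] within
   [B] of [p], hence in the range of [normal_lip] and [normal_reflected]. *)
pose B := Num.min r b; have B0 : 0 < B by rewrite lt_min r0.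
pose eta := Num.min 1 (B / r).
have eta0 : 0 < eta by rewrite lt_min ltr01 divr_gt0.
have [del2 del20 expc] := grad_continuous _ _ (diffG _ x0r) _ eta0.
have [h [h0 hd1 hd2 hB ht]] : exists h, [/\ 0 < h, h < del1, h < del2,
    4 * h <= B & 36 * h <= r].
  pose m := Num.min (Num.min (del1 / 2) (del2 / 2)) (Num.min (B / 4) (r / 36)).
  have : m <= m by [].
  rewrite {2}/m !le_min => /andP[/andP[m1 m2] /andP[m3 m4]].
  have m0 : 0 < m by rewrite /m !lt_min !divr_gt0.
  by exists m; split=> //; lra.
have he : enorm (- h *: e) = h by rewrite enormZ enorm1 // mulr1 normrN gtr0_norm.
have [x xE] : exists x, x = p + t *: u + - h *: e by exists (p + t *: u + - h *: e).
have := exph (- h *: e); rewrite he -xE => /(_ hd1).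
have := expc (- h *: e); rewrite he -xE => /(_ hd2).
rewrite gx hessZl kE.
have xx0 : enorm (x - (p + t *: u)) = h by rewrite xE (addrC (p + _)) addrK.
have dxt1 : d x <= t + h by rewrite -dx -xx0; exact: dist_leD.
have dxt2 : t - h <= d x.
  rewrite lerBlDr -dx -xx0 enormB; exact: dist_leD.
have x0 : 0 < d x by lra.
have xr : 0 < d x <= r by rewrite x0 /=; lra.
have [q Sq xq] := projection S0 clS x.
have nv := normal_grad S0 clS r0 diffd _ _ xr Sq xq.
have [_ xE'] := grad_dist S0 _ _ (diffd _ xr) x0 Sq xq.
move: (grad d x) nv xE' => v nv xE' hvu.
have [_ v1 _] := nv.
rewrite dotBl ue subr0 => hve.
have {hve} : `|dot v e + h / t| <= c * h by move: hve; rewrite mulNr opprK.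
rewrite ler_norml => /andP[hve1 hve2].
have ct : c * 18 * t = 1 by rewrite /c rE; field; rewrite gt_eqF.
have htE : h / t = 18 * (c * h).
  have hE : h = 18 * (c * h) * t.
    rewrite (_ : 18 * (c * h) * t = c * 18 * t * h); last by ring.
    by rewrite ct mul1r.
  by rewrite {1}hE mulfK // gt_eqF.
have ch0 : 0 < c * h by rewrite mulr_gt0.
have hu : q - p = t *: (u - v) + ((t - d x) *: v + - h *: e).
  have -> : q = p + t *: u + - h *: e - d x *: v by rewrite -xE {1}xE' addrK.
  by apply: row2P; rewrite !mxE; ring.
have [w wE] : exists w, w = q - p by exists (q - p).
have euv : enorm (u - v) <= eta by rewrite enormB.
have etar : t * eta <= B / 2.
  have : eta <= B / r by rewrite /eta ge_min lexx orbT.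
  rewrite ler_pdivlMr // => hh.
  have : eta * (2 * t) <= B by rewrite -rE.
  lra.
have wB : enorm w <= B.
  rewrite wE hu; apply: le_trans (enormD _ _) _.
  rewrite enormZ (gtr0_norm t0).
  have h1 : t * enorm (u - v) <= t * eta by rewrite ler_pM2l.
  have := enormD ((t - d x) *: v) (- h *: e).
  rewrite he enormZ (enorm1 _ v1) mulr1.
  have : `|t - d x| <= h by rewrite ler_norml; apply/andP; split; lra.
  by move: (enorm (_ + _)) => E; lra.
have wr : enorm w <= r by apply: le_trans wB _; rewrite /B ge_min lexx.
have wb : enorm w <= b by apply: le_trans wB _; rewrite /B ge_min lexx orbT.
(* Otherwise [v] would be a normal at [p] with negative component along [e], and [- e] would be
   normal. *)
have qp : q != p.
  apply/eqP => qp; apply: neN; rewrite qp in nv.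
  apply: (normal_orth S0 clS r0 diffd _ _ _ _ nu nuN nv).
  - by rewrite dotNl dotNr opprK.
  - by rewrite dotNr ue oppr0.
  - by rewrite dotNr oppr_gt0; lra.
have nvN : nor q (- v) by apply: (refl q v) => //; rewrite -wE.
have uv : 0 <= dot u v.
  have : enorm (u - v) <= 1 by apply: le_trans euv _; rewrite /eta ge_min lexx.
  by move=> /dot_le_enorm; rewrite dotBB u1 v1; lra.
have lip : enorm (u - v) <= 2 / r * enorm w.
  have pq : p != q by rewrite eq_sym.
  have pqr : enorm (p - q) <= r by rewrite enormB -wE.
  have := normal_lip r0 p q u v nu nuN nv nvN uv pq pqr.
  by rewrite (enormB p) -wE.
(* In [- h - d x * dot v e] the main terms cancel. What remains is the Hessian error times [d x],
   and [d x - t] times [h / t], which [36 * h <= r] makes comparable to it. *)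
have we : `|dot w e| <= 4 * t * (c * h).
  have -> : dot w e = - d x * (dot v e + h / t) + (d x - t) * (h / t).
    have -> : dot w e = t * (0 - dot v e) + ((t - d x) * dot v e + - h * 1).
      by rewrite wE hu !(dotDl, dotZl) dotNl ue e1 sub0r.
    by field; rewrite gt_eqF.
  have hv3 : `|dot v e + h / t| <= c * h by rewrite ler_norml hve1.
  apply: le_trans (ler_normD _ _) _; rewrite (normrM (- d x)) (normrM (d x - t)).
  rewrite normrN (gtr0_norm x0).
  have h1 : `|d x - t| <= h by rewrite ler_norml; apply/andP; split; lra.
  have h2 : d x * `|dot v e + h / t| <= (2 * t) * (c * h).
    by apply: ler_pM => //; [exact: ltW|lra].
  have h3 : `|d x - t| * `|h / t| <= (t / 18) * (18 * (c * h)).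
    by rewrite htE (gtr0_norm (_ : 0 < 18 * (c * h))) ?mulr_gt0 // ler_pM2r ?mulr_gt0 //; lra.
  have := mulr_gt0 t0 ch0; lra.
have wu : `|dot w u| <= enorm w / 2.
  have := normal_chord r0 _ _ _ nu nuN Sq; rewrite -wE => /le_trans; apply.
  rewrite mulrC ler_wpM2l ?enorm_ge0 // ler_pdivrMr ?mulr_gt0 //; lra.
have ww : dot w w = dot w u ^+ 2 + dot w e ^+ 2.
  rewrite {1 2}(orth_decomp u e w u1 e1 ue) dotDD !dotZZ dotZl dotZr u1 e1 ue; ring.
have w2 : enorm w <= 2 * `|dot w e|.
  rewrite -(ler_pXn2r (n := 2)) ?nnegrE ?enorm_ge0 ?mulr_ge0 //.
  rewrite exprMn real_normK ?num_real //.
  have : `|dot w u| ^+ 2 <= (enorm w / 2) ^+ 2.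
    by rewrite ler_pXn2r ?nnegrE ?divr_ge0 ?enorm_ge0.
  rewrite real_normK ?num_real //; rewrite -enorm_sqr in ww; have := sqr_ge0 (dot w e); lra.
have h17 : 17 * (c * h) <= enorm (u - v).
  have := dot_abs_le (u - v) e; rewrite (enorm1 _ e1) mulr1 dotBl ue sub0r normrN.
  apply: le_trans; rewrite ler_normr; apply/orP; right; lra.
have : 2 / r * enorm w <= 2 / r * (8 * t * (c * h)).
  by rewrite ler_pM2l ?divr_gt0 //; lra.
have -> : 2 / r * (8 * t * (c * h)) = 8 * (c * h) by rewrite rE; field; rewrite gt_eqF.
lra.
Qed.

Lemma normal_line : (forall q, S q -> exists2 v, nor q v & nor q (- v)) ->
  connected S -> (forall p, S <> [set p]) ->
  forall p, S p -> exists n, [/\ nor p n, nor p (- n) &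
    forall v, nor p v -> v = n \/ v = - n].
Proof.
move=> anti cS nS p Sp; have [n nn nnN] := anti p Sp; exists n; split=> // v nv.
have [->|/eqP vn] := eqVneq v n; first by left.
have [->|/eqP vnN] := eqVneq v (- n); first by right.
have [e [e1 ne nne]] := normal_half S0 clS r0 diffd _ _ _ nn nnN nv vn vnN.
have nneN := normal_pair_full _ _ _ anti nn nnN nne ne.
exfalso; apply: (nS p); apply: (normal_all_set1 r0) => // w w1.
exact: (normal_full S0 clS r0 diffd p n e).
Qed.

End NoHalf.

(** * Functions that are o(h) at 0, and derivatives on the line *)

Section LittleO.
Context {R : realType}.
Implicit Types (f g : R -> R) (a b c s h : R).

Definition is_oh f := forall e : R, 0 < e -> exists2 del : R, 0 < del &
  forall h, `|h| < del -> `|f h| <= e * `|h|.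

Lemma oh_ext f g a : 0 < a -> (forall h, `|h| < a -> f h = g h) -> is_oh f -> is_oh g.
Proof.
move=> a0 fg of_ e e0; have [del del0 hd] := of_ e e0.
exists (Num.min a del); first by rewrite lt_min a0.
by move=> h; rewrite lt_min => /andP[ha hdel]; rewrite -fg //; exact: hd.
Qed.

Lemma ohD f g : is_oh f -> is_oh g -> is_oh (fun h => f h + g h).
Proof.
move=> of_ og e e0; have e2 : 0 < e / 2 by rewrite divr_gt0.
have [d1 d10 h1] := of_ _ e2; have [d2 d20 h2] := og _ e2.
exists (Num.min d1 d2); first by rewrite lt_min d10.
move=> h; rewrite lt_min => /andP[/h1 {}h1 /h2 {}h2].
by apply: le_trans (ler_normD _ _) _; lra.
Qed.

Lemma oh_mul f g C a : 0 < a -> (forall h, `|h| < a -> `|g h| <= C) -> is_oh f ->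
  is_oh (fun h => g h * f h).
Proof.
move=> a0 gC of_ e e0.
have C0 : 0 <= C by apply: le_trans (gC 0 _); rewrite ?normr0.
have C1 : 0 < C + 1 by lra.
have [del del0 hd] := of_ (e / (C + 1)) (divr_gt0 e0 C1).
exists (Num.min a del); first by rewrite lt_min a0.
move=> h; rewrite lt_min => /andP[/gC hg /hd hf]; rewrite normrM.
have -> : e * `|h| = (C + 1) * (e / (C + 1) * `|h|).
  by rewrite mulrA (mulrC _ (e / _)) divfK ?gt_eqF.
by apply: ler_pM => //; lra.
Qed.

Lemma ohZ f c : is_oh f -> is_oh (fun h => c * f h).
Proof. exact: (oh_mul f (fun=> c) `|c| 1). Qed.

Lemma oh_sqr f C a : 0 < a -> (forall h, `|h| < a -> `|f h| <= C * `|h| ^+ 2) -> is_oh f.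
Proof.
move=> a0 fC e e0; have C1 : 0 < `|C| + 1 by rewrite ltr_wpDl.
exists (Num.min a (e / (`|C| + 1))); first by rewrite lt_min a0 divr_gt0.
move=> h; rewrite lt_min => /andP[/fC hf]; rewrite ltr_pdivlMr // => hh.
apply: le_trans hf _; rewrite expr2 mulrA ler_wpM2r //.
apply: le_trans (_ : `|C| * `|h| <= e); first by rewrite ler_wpM2r ?ler_norm.
have := normr_ge0 h; lra.
Qed.

Lemma oh_is_derive f s c : is_oh (fun h => f (s + h) - f s - c * h) -> is_derive s 1 f c.
Proof.
move=> H; have cv : h^-1 *: (f (h *: 1 + s) - f s) @[h --> 0^'] --> c.
  apply/(@cvgrPdist_le _ _ _ _) => e e0; have [del del0 hd] := H e e0.
  apply/nbhs_ballP; exists del => //= h; rewrite -ball_normE /= sub0r normrN => hh h0.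
  have := hd h hh; have hn : 0 < `|h| by rewrite normr_gt0.
  have -> : h *: 1 + s = s + h by rewrite addrC [h *: 1]mulr1.
  have -> : f (s + h) - f s - c * h = - (h * (c - h^-1 *: (f (s + h) - f s))).
    by rewrite /GRing.scale /=; field.
  by rewrite normrN normrM mulrC ler_pM2r.
by apply: DeriveDef; [apply/cvg_ex; exists c|exact: cvg_lim].
Qed.

Lemma local_lip_continuous (V : normedModType R) (f : R -> V) (s a C : R) :
  0 < a -> (forall h : R, `|h| < a -> `|f (s + h) - f s| <= C * `|h|) ->
  {for s, continuous f}.
Proof.
move=> a0 lf; apply/(@cvgrPdist_le _ _ _ (nbhs s)) => e e0.
have C1 : 0 < `|C| + 1 by rewrite ltr_wpDl.
apply/nbhs_ballP; exists (Num.min a (e / (`|C| + 1))) => /=.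
  by rewrite lt_min a0 divr_gt0.
move=> x; rewrite -ball_normE /= distrC lt_min => /andP[h1 h2].
have := lf (x - s) h1; rewrite (_ : s + (x - s) = x); last by rewrite addrC subrK.
rewrite distrC => /le_trans; apply.
move: h2; rewrite ltr_pdivlMr // => h2.
apply: le_trans (_ : `|C| * `|x - s| <= e); first by rewrite ler_wpM2r ?ler_norm.
have := normr_ge0 (x - s); lra.
Qed.

End LittleO.

(** * Derivatives of the graph, computed from its normals *)

Section GraphDerivatives.
Context {R : realType} {S : set 'rV[R]_2} {r : R}.
Implicit Types (q u v w x y z : 'rV[R]_2) (b c s h : R).
Hypothesis S0 : S !=set0.
Hypothesis r0 : 0 < r.
Local Notation d := (dist_to S).
Local Notation nor := (normal (S := S) r).
Hypothesis diffd : forall x, 0 < d x <= r -> differentiable (d : 'rV[R]_2 -> R) x.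
Hypothesis diffG : forall x, 0 < d x <= r -> forall i : 'I_2,
  differentiable ('D_(delta_mx ord0 i) (d : 'rV[R]_2 -> R)) x.
Hypothesis contH : forall x, 0 < d x <= r -> forall i j : 'I_2,
  {for x, continuous ('D_(delta_mx ord0 j) ('D_(delta_mx ord0 i) (d : 'rV[R]_2 -> R)))}.

Variables (p n : 'rV[R]_2) (a : R) (Q N : R -> 'rV[R]_2).
Hypothesis n1 : dot n n = 1.
Hypothesis QN : forall s, `|s| < a -> [/\ nor (Q s) (N s), nor (Q s) (- N s),
  dot (Q s - p) (perp n) = s & 3 / 4 <= dot (N s) n].
Hypothesis QL : forall s s', `|s| < a -> `|s'| < a ->
  enorm (Q s - Q s') <= 2 * `|s - s'|.
Hypothesis NL : forall s s', `|s| < a -> `|s'| < a ->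
  enorm (N s - N s') <= 4 / r * `|s - s'|.

Let t := r / 2.
Let Y s := Q s + t *: N s.
Let T s := perp (N s).
Let k s := hess d (Y s) (T s) (T s).
Let g s := dot (Q s - p) n.
Let g1 s := - dot (N s) (perp n) / dot (N s) n.
(** [k] is the curvature of the parallel curve at distance [t], and [k / (1 - t * k)] that of [S].
    The second derivative of a graph is minus this curvature times the 3/2 power of [1 + g1 ^+ 2],
    which is the inverse square of [dot N n]. *)
Let g2 s := - k s / ((1 - t * k s) * dot (N s) n ^+ 3).

Lemma t_gt0 : 0 < t. Proof. by rewrite divr_gt0. Qed.
Lemma t_le : t <= r. Proof. have := r0; rewrite /t; lra. Qed.

Lemma N_unit s : `|s| < a -> dot (N s) (N s) = 1.
Proof. by move=> /QN[[]]. Qed.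

Lemma N_pos s : `|s| < a -> 0 < dot (N s) n.
Proof. by move=> /QN[_ _ _]; lra. Qed.

Lemma graph_window s : `|s| < a -> exists2 b, 0 < b &
  forall h, `|h| < b -> `|s + h| < a.
Proof.
move=> sa; exists (a - `|s|); first by rewrite subr_gt0.
by move=> h hb; apply: le_lt_trans (ler_normD _ _) _; lra.
Qed.

Lemma graph_chord s s' : `|s| < a -> `|s'| < a ->
  `|dot (Q s' - Q s) (N s)| <= 2 / r * `|s' - s| ^+ 2.
Proof.
move=> sa sa'; have [nv nvN _ _] := QN s sa; have [[SQ' _ _] _ _ _] := QN s' sa'.
have r2 : 0 < 2 * r by rewrite mulr_gt0.
apply: le_trans (normal_chord r0 _ _ _ nv nvN SQ') _.
have h := QL s' s sa' sa; have := enorm_ge0 (Q s' - Q s); move: (enorm _) h => E h E0.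
rewrite (_ : E / (2 * r) * E = E ^+ 2 / (2 * r)); last by field; rewrite gt_eqF.
rewrite ler_pdivrMr // (_ : _ * (2 * r) = (2 * `|s' - s|) ^+ 2); last first.
  by field; rewrite gt_eqF.
by rewrite ler_pXn2r ?nnegrE ?mulr_ge0.
Qed.

Lemma dotN_perp s s' : `|s| < a -> `|s'| < a ->
  g1 s' - g1 s = - dot (N s' - N s) (T s) / (dot (N s') n * dot (N s) n).
Proof.
move=> sa sa'; have h := N_pos s sa; have h' := N_pos s' sa'.
(* The factor [dot n n], equal to 1, turns the next equality into a polynomial identity. *)
have -> : dot (N s' - N s) (T s) = dot n n * dot (N s') (T s).
  by rewrite n1 mul1r dotBl (dotC (N s)) dot_perp subr0.
have -> : dot n n * dot (N s') (T s) = dot (N s') (perp n) * dot (N s) n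
    - dot (N s) (perp n) * dot (N s') n.
  by rewrite /T /dot !perpE; ring.
by rewrite /g1; field; rewrite !gt_eqF.
Qed.

Lemma chord_split s s' : `|s| < a -> `|s'| < a ->
  dot (Q s' - Q s) (N s) = (s' - s) * dot (N s) (perp n) + (g s' - g s) * dot (N s) n
  /\ dot (Q s' - Q s) (T s) = (s' - s) * dot (N s) n - (g s' - g s) * dot (N s) (perp n).
Proof.
move=> sa sa'; have [_ _ e _] := QN s sa; have [_ _ e' _] := QN s' sa'.
have pn : dot (perp n) (perp n) = 1 by rewrite perp_unit.
have pn0 : dot (perp n) n = 0 by exact: dot_perp.
have E : Q s' - Q s = (s' - s) *: perp n + (g s' - g s) *: n.
  rewrite {1}(orth_decomp (perp n) n (Q s' - Q s) pn n1 pn0).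
  have -> : Q s' - Q s = (Q s' - p) - (Q s - p) by rewrite opprB addrA subrK.
  by rewrite !(dotBl (Q s' - p)) e e'.
rewrite E !dotDl !dotZl !(dotC (N s)); split=> //.
by congr (_ * _ + _); rewrite /T /dot !perpE; ring.
Qed.

(** The component of a chord along the normal is quadratically small; by [chord_split] it is the
    error of the linear approximation of [g] multiplied by [dot (N s) n]. *)
Lemma graph_derive s : `|s| < a -> is_derive s 1 g (g1 s).
Proof.
move=> sa; apply: oh_is_derive; have [b b0 hb] := graph_window s sa.
have np := N_pos s sa.
apply: (oh_ext (fun h => (dot (N s) n)^-1 * dot (Q (s + h) - Q s) (N s)) _ b b0).
  move=> h /hb sh; have [-> _] := chord_split s (s + h) sa sh.
  by rewrite (addrC s h) addrK /g1; field; rewrite gt_eqF.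
apply: ohZ; apply: (oh_sqr _ (2 / r) b b0) => h /hb sh.
by have := graph_chord s (s + h) sa sh; rewrite (addrC s h) addrK.
Qed.

Lemma Y_dist s : `|s| < a -> 0 < d (Y s) <= r.
Proof.
move=> /QN[nv _ _ _]; rewrite (normal_dist S0 _ _ _ _ nv (ltW t_gt0) t_le).
by rewrite t_gt0 t_le.
Qed.

Lemma grad_Y s : `|s| < a -> grad d (Y s) = N s.
Proof.
by move=> /QN[nv _ _ _]; exact: (normal_gradE S0 diffd _ _ _ _ nv t_gt0 t_le t_le).
Qed.

Lemma Y_lip s s' : `|s| < a -> `|s'| < a -> enorm (Y s - Y s') <= 4 * `|s - s'|.
Proof.
move=> sa sa'; have -> : Y s - Y s' = (Q s - Q s') + t *: (N s - N s').
  by rewrite /Y opprD addrACA -scalerBr.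
apply: le_trans (enormD _ _) _; rewrite enormZ (gtr0_norm t_gt0).
have : t * enorm (N s - N s') <= t * (4 / r * `|s - s'|).
  by rewrite ler_pM2l ?t_gt0 // NL.
have -> : t * (4 / r * `|s - s'|) = 2 * `|s - s'| by rewrite /t; field; rewrite gt_eqF.
by have := QL s s' sa sa'; lra.
Qed.

(* With [al], [be] the tangential increments of [N] and [Q], differentiating
   [grad d (Y s) = N s] gives [al = k (be + t al)] to first order, where
   [be ~ h / <N, n>]. *)
Lemma curvature_eq s : `|s| < a -> is_oh (fun h =>
  (1 - t * k s) * dot (N (s + h) - N s) (T s) - k s / dot (N s) n * h).
Proof.
move=> sa; have [b b0 hb] := graph_window s sa; have np := N_pos s sa.
have N1 := N_unit s sa; have T1 : dot (T s) (T s) = 1 by rewrite perp_unit.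
have NT : dot (N s) (T s) = 0 by rewrite dotC dot_perp.
have rn := r0.
pose kap := hess d (Y s) (N s) (T s).
pose Z h := Y (s + h) - Y s.
(* For unit vectors, [dot (N (s + h) - N s) (N s)] is minus half the squared norm of the difference,
   so both parts of [Z h] are quadratically small along [N s]. *)
have ZN : is_oh (fun h => dot (Z h) (N s)).
  apply: (oh_sqr _ (6 / r) b b0) => h /hb sh.
  have -> : Z h = (Q (s + h) - Q s) + t *: (N (s + h) - N s).
    by rewrite /Z /Y opprD addrACA -scalerBr.
  rewrite dotDl dotZl; apply: le_trans (ler_normD _ _) _.
  have h1 := graph_chord s (s + h) sa sh; rewrite (addrC s h) addrK in h1.
  rewrite (addrC s h) in sh *.
  have h2 := NL (h + s) s sh sa; rewrite addrK in h2.
  have N1' := N_unit _ sh.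
  have h3 := dot_le_enorm _ _ h2; rewrite dotBB N1' N1 in h3.
  have h4 : dot (N (h + s) - N s) (N s) = - (2 - 2 * dot (N (h + s)) (N s)) / 2.
    by rewrite dotBl N1; field.
  have h5 := dot_ge0 (N (h + s) - N s); rewrite dotBB N1' N1 in h5.
  have h6 : `|t * dot (N (h + s) - N s) (N s)| <= t * ((4 / r * `|h|) ^+ 2 / 2).
    rewrite normrM (gtr0_norm t_gt0) ler_pM2l ?t_gt0 // h4 ler_norml.
    by apply/andP; split; lra.
  have h7 : t * ((4 / r * `|h|) ^+ 2 / 2) = 4 / r * `|h| ^+ 2.
    by rewrite /t; field; rewrite gt_eqF.
  rewrite h7 in h6; apply: le_trans (lerD h1 h6) _.
  by rewrite -mulrDl -mulrDl -natrD.
(* Because [mu ^+ 2 + dot (N s) n ^+ 2 = 1], this quantity is a multiple of the component of the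
   chord along the normal. *)
have be : is_oh (fun h => dot (Q (s + h) - Q s) (T s) - h / dot (N s) n).
  pose mu := dot (N s) (perp n).
  apply: (oh_ext (fun h => - (mu / dot (N s) n) * dot (Q (s + h) - Q s) (N s)) _ b b0).
    move=> h /hb sh; have [-> ->] := chord_split s (s + h) sa sh.
    rewrite -/mu (addrC s h) addrK; move: (g _ - _) => ga.
    have e : mu ^+ 2 + dot (N s) n ^+ 2 = 1.
      have := N1; rewrite {1 2}(orth_decomp (perp n) n (N s) _ n1 (dot_perp n)) ?perp_unit //.
      by rewrite dotDD !dotZZ dotZl dotZr perp_unit n1 dot_perp => <-; rewrite /mu; ring.
    have -> : h / dot (N s) n = h * (mu ^+ 2 + dot (N s) n ^+ 2) / dot (N s) n.
      by rewrite e mulr1.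
    by field; rewrite gt_eqF.
  apply: ohZ; apply: (oh_sqr _ (2 / r) b b0) => h /hb sh.
  by have := graph_chord s (s + h) sa sh; rewrite (addrC s h) addrK.
have E : is_oh (fun h => dot (N (s + h) - N s) (T s) - hess d (Y s) (Z h) (T s)).
  move=> e e0; have e4 : 0 < e / 4 by rewrite divr_gt0.
  have [del del0 he] := hess_expansion _ _ _ (diffG _ (Y_dist s sa)) T1 _ e4.
  exists (Num.min b (del / 4)); first by rewrite lt_min b0 divr_gt0.
  move=> h; rewrite lt_min => /andP[/hb sh hd].
  have zh : enorm (Z h) <= 4 * `|h|.
    by have := Y_lip (s + h) s sh sa; rewrite (_ : s + h - s = h) // (addrC s) addrK.
  have zd : enorm (Z h) < del by lra.
  have YZ : Y s + Z h = Y (s + h) by rewrite /Z addrC subrK.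
  have := he _ zd; rewrite YZ (grad_Y _ sh) (grad_Y _ sa) => /le_trans; apply.
  rewrite (_ : e * `|h| = e / 4 * (4 * `|h|)); last by field.
  by rewrite ler_pM2l.
apply: (oh_ext (fun h => (dot (N (s + h) - N s) (T s) - hess d (Y s) (Z h) (T s))
  + (kap * dot (Z h) (N s) + k s * (dot (Q (s + h) - Q s) (T s) - h / dot (N s) n)))
  _ b b0); last by apply: ohD => //; apply: ohD; exact: ohZ.
move=> h /hb sh.
have -> : hess d (Y s) (Z h) (T s) = dot (Z h) (N s) * kap + dot (Z h) (T s) * k s.
  by rewrite {1}(orth_decomp (N s) (T s) (Z h) N1 T1 NT) hessDl !hessZl.
have -> : dot (Z h) (T s) = dot (Q (s + h) - Q s) (T s)
    + t * dot (N (s + h) - N s) (T s).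
  by rewrite -dotZl -dotDl /Z /Y opprD addrACA -scalerBr.
by field; rewrite gt_eqF.
Qed.

(** If [1 - t * k s] vanished, [curvature_eq] would leave a multiple of [h] that is o(h), whence
    [k s = 0] and [1 - t * k s = 1]. *)
Lemma curvature_ne0 s : `|s| < a -> 1 - t * k s != 0.
Proof.
move=> sa; apply/eqP => e0; have [b b0 hb] := graph_window s sa.
have np := N_pos s sa; have := curvature_eq s sa; rewrite e0 => H.
have k0 : k s != 0.
  apply/eqP => k0; move: e0; rewrite k0 mulr0 subr0 => /eqP.
  by rewrite oner_eq0.
have c0 : 0 < `|k s / dot (N s) n| / 2.
  by rewrite divr_gt0 // normr_gt0 mulf_neq0 // invr_neq0 // gt_eqF.
have [del del0 hd] := H _ c0.
have del2 : 0 < del / 2 by rewrite divr_gt0.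
have dd : `|del / 2| < del by rewrite gtr0_norm //; lra.
have := hd _ dd; rewrite mul0r sub0r normrN normrM (gtr0_norm del2).
by rewrite ler_pM2r //; lra.
Qed.

Lemma graph_derive2 s : `|s| < a -> is_derive s 1 g1 (g2 s).
Proof.
move=> sa; apply: oh_is_derive; have [b b0 hb] := graph_window s sa.
have np := N_pos s sa; have ne := curvature_ne0 s sa.
have rn := r0.
pose A := k s / (dot (N s) n * (1 - t * k s)).
have HA : is_oh (fun h => dot (N (s + h) - N s) (T s) - A * h).
  have := ohZ _ (1 - t * k s)^-1 (curvature_eq s sa).
  apply: (oh_ext _ _ b b0) => h _; rewrite /A; field.
  by rewrite ne gt_eqF.
have bnd h : `|h| < b -> `|(dot (N (s + h)) n * dot (N s) n)^-1| <= 16 / 9.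
  move=> /hb sh; have [_ _ _ p1] := QN _ sh; have [_ _ _ p2] := QN _ sa.
  have p3 : 3 / 4 * (3 / 4) <= dot (N (s + h)) n * dot (N s) n by apply: ler_pM => //; lra.
  rewrite ger0_norm ?invr_ge0; last by lra.
  rewrite -[leRHS]invrK lef_pV2 ?posrE; lra.
have H1 := oh_mul _ _ _ _ b0 bnd HA.
(* The price of replacing the denominator [dot (N (s + h)) n] by its value at [s]: the change of
   [dot N n] is of order [h]. *)
have H2 : is_oh (fun h => (A / dot (N s) n ^+ 2 * (dot (N (s + h) - N s) n * h))).
  apply: ohZ; apply: (oh_sqr _ (4 / r) b b0) => h /hb sh.
  rewrite normrM expr2 mulrA ler_wpM2r //.
  have := dot_abs_le (N (s + h) - N s) n; rewrite (enorm1 _ n1) mulr1 => /le_trans; apply.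
  by have := NL (s + h) s sh sa; rewrite (_ : s + h - s = h) // (addrC s) addrK.
have H3 := oh_mul _ _ _ _ b0 bnd H2.
have := ohD _ _ (ohZ _ (- 1) H1) (ohZ _ (dot (N s) n) H3).
apply: (oh_ext _ _ b b0) => h /hb sh.
have np' := N_pos _ sh.
rewrite (dotN_perp _ _ sa sh) /g2 /A (dotBl _ _ n); field.
by rewrite ne !gt_eqF.
Qed.

(** [Y] and [N] are Lipschitz, and [k] is a polynomial in the coordinates of [N] and the second
    derivatives of [d] at [Y], which are continuous at distance [t] from [S]. *)
Lemma graph_derive2_continuous s : `|s| < a -> {for s, continuous g2}.
Proof.
move=> sa; have [b b0 hb] := graph_window s sa.
have cM (f h : R -> R) : {for s, continuous f} -> {for s, continuous h} ->
    {for s, continuous (fun c => f c * h c)}.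
  by move=> cf ch; exact: cvgM cf ch.
have cD (f h : R -> R) : {for s, continuous f} -> {for s, continuous h} ->
    {for s, continuous (fun c => f c + h c)}.
  by move=> cf ch; exact: cvgD cf ch.
have cN (f : R -> R) : {for s, continuous f} -> {for s, continuous (fun c => - f c)}.
  by move=> cf; exact: cvgN cf.
have cC (c : R) : {for s, continuous (fun _ : R => c)} by exact: cst_continuous.
have NE h : `|h| < b -> enorm (N (s + h) - N s) <= 4 / r * `|h|.
  by move=> /hb sh; have := NL _ _ sh sa; rewrite (_ : s + h - s = h) // (addrC s) addrK.
have YE h : `|h| < b -> enorm (Y (s + h) - Y s) <= 4 * `|h|.
  move=> /hb sh; have := Y_lip (s + h) s sh sa.
  by rewrite (_ : s + h - s = h) // (addrC s) addrK.
have Yc : {for s, continuous Y}.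
  apply: (local_lip_continuous _ Y s b 4 b0) => h hh.
  exact: le_trans (norm_le_enorm _) (YE _ hh).
have Nc i : {for s, continuous (fun c => N c ord0 i)}.
  apply: (local_lip_continuous R (fun c => N c ord0 i) s b (4 / r) b0) => h hh.
  apply: le_trans (NE _ hh); have := coord_le_enorm (N (s + h) - N s) i.
  by rewrite !mxE.
have Hc i j : {for s, continuous (fun c =>
    'D_(delta_mx ord0 j) ('D_(delta_mx ord0 i) (d : 'rV[R]_2 -> R)) (Y c))}.
  have := Y_dist s sa => Ys.
  exact: continuous_comp Yc (contH _ Ys i j).
have kc : {for s, continuous k}.
  pose H i j c := 'D_(delta_mx ord0 j) ('D_(delta_mx ord0 i) (d : 'rV[R]_2 -> R)) (Y c).
  have -> : k = fun c =>
     (H ord0 ord0 c * - N c ord0 ord_max + H ord0 ord_max c * N c ord0 ord0)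
       * - N c ord0 ord_max +
     (H ord_max ord0 c * - N c ord0 ord_max + H ord_max ord_max c * N c ord0 ord0)
       * N c ord0 ord0.
    by apply/funext => c; rewrite /k hess_coord /T perp0 perp1.
  by apply: (cD _ _); apply: (cM _ _); (try apply: (cN _)) => //;
    apply: (cD _ _); apply: (cM _ _);
    (try apply: (cN _)) => //; exact: Hc.
have np := N_pos s sa.
have ne := curvature_ne0 s sa.
have nc : {for s, continuous (fun c => dot (N c) n)}.
  by apply: (cD _ _); apply: (cM _ _) => //; exact: cC.
apply: (cM _ _); first exact: cN.
apply: cvgV; first by rewrite mulf_neq0 // expf_neq0 // gt_eqF.
apply: (cM (fun c => 1 - t * k c) (fun c => dot (N c) n ^+ 3)).
  by apply: (cD _ _) => //; apply: (cN _); apply: (cM _ _).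
have -> : (fun c => dot (N c) n ^+ 3) = fun c => dot (N c) n * (dot (N c) n * dot (N c) n).
  by apply/funext => c; rewrite !exprS expr0 mulr1.
by apply: (cM _ _) => //; apply: (cM _ _).
Qed.

End GraphDerivatives.

(** * The set near one of its points, as a graph over the tangent line *)

Lemma dist_window (R : realDomainType) (t c u : R) :
  c <= t + u -> t - u <= c -> `|t - c| <= u.
Proof. by move=> h1 h2; rewrite ler_norml; apply/andP; split; lra. Qed.

Lemma same_sign (R : realFieldType) (u b : R) :
  `|u - b| <= 3 / 8 * `|b| -> (0 < u -> 0 < b) /\ (u < 0 -> b < 0).
Proof.
move=> h; split=> hu; rewrite ltNge; apply/negP => hb.
  rewrite (ler0_norm hb) ger0_norm in h; lra.
rewrite (ger0_norm hb) ler0_norm in h; lra.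
Qed.

Section LocalGraph.
Context {R : realType} {S : set 'rV[R]_2} {r : R}.
Implicit Types (q v w x y z : 'rV[R]_2) (a b c s h u : R).
Hypothesis S0 : S !=set0.
Hypothesis clS : closed S.
Hypothesis r0 : 0 < r.
Local Notation d := (dist_to S).
Local Notation nor := (normal (S := S) r).
Hypothesis diffd : forall x, 0 < d x <= r -> differentiable (d : 'rV[R]_2 -> R) x.
Hypothesis diffG : forall x, 0 < d x <= r -> forall i : 'I_2,
  differentiable ('D_(delta_mx ord0 i) (d : 'rV[R]_2 -> R)) x.
Hypothesis line : forall q, S q -> exists n, [/\ nor q n, nor q (- n) &
    forall v, nor q v -> v = n \/ v = - n].

Variables (p n : 'rV[R]_2).
Hypothesis nn : nor p n.
Hypothesis nnN : nor p (- n).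

(** Of the two opposite normals at [q], this picks the one on the side of [n]. The two bounds match:
    [2 / r * (r / 8) = 1 / 4] in [normal_lip]. *)
Definition near_normal q v :=
  [/\ nor q v, nor q (- v), enorm (q - p) <= r / 8 & enorm (v - n) <= 1 / 4].

Lemma near_normal_dot q v : near_normal q v -> 3 / 4 <= dot v n.
Proof.
move=> [[_ v1 _] _ _ /dot_le_enorm]; have [_ n1 _] := nn.
by rewrite dotBB v1 n1; lra.
Qed.

Lemma near_normal_dist q v q' v' : near_normal q v -> near_normal q' v' ->
  enorm (q - q') <= r / 4.
Proof.
move=> [_ _ h _] [_ _ h' _]; apply: le_trans (enorm_triangle q p q') _.
by rewrite (enormB p); lra.
Qed.

Lemma near_normal_lip q v q' v' : near_normal q v -> near_normal q' v' ->
  enorm (v - v') <= 2 / r * enorm (q - q').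
Proof.
move=> nv nv'; have qr := near_normal_dist _ _ _ _ nv nv'.
have [nq nqN _ hv] := nv; have [nq' nqN' _ hv'] := nv'.
have [Sq v1 _] := nq; have [_ v1' _] := nq'.
have vv : enorm (v - v') <= 1 / 2.
  by apply: le_trans (enorm_triangle v n v') _; rewrite (enormB n); lra.
have := dot_le_enorm _ _ vv; rewrite dotBB v1 v1' => vv'.
(* At a single point [line] leaves only equal or opposite normals, and opposite ones are too far
   apart. *)
have [qq'|qq'] := eqVneq q q'; last first.
  apply: (normal_lip r0 _ _ _ _ nq nqN nq' nqN') => //; [lra|have := r0; lra].
rewrite -qq' in nq' *; rewrite subrr enorm0 mulr0.
suff -> : v = v' by rewrite subrr enorm0.
have [m [_ _ hm]] := line q Sq.
have [vm|vm] := hm v nq; have [vm'|vm'] := hm v' nq'; rewrite ?vm ?vm' //.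
  by exfalso; move: vv'; rewrite vm' dotNr -vm v1; lra.
by exfalso; move: vv'; rewrite vm dotNl -vm' v1'; lra.
Qed.

(** The component along [n] is at most 3/8 of the chord: 1/8 from [normal_chord], 1/4 from [v - n].
    This slope bound also gives uniqueness, since points with equal tangential coordinates
    coincide. *)
Lemma near_normal_tangent q v q' v' : near_normal q v -> near_normal q' v' ->
  enorm (q' - q) <= 2 * `|dot (q' - q) (perp n)|.
Proof.
move=> nv nv'; have qr := near_normal_dist _ _ _ _ nv nv'.
have [nq nqN _ hv] := nv; have [[Sq' _ _] _ _ _] := nv'; have [_ n1 _] := nn.
have rn := r0.
rewrite enormB in qr.
have h1 := normal_chord r0 _ _ _ nq nqN Sq'.
have h2 : `|dot (q' - q) (n - v)| <= enorm (q' - q) * (1 / 4).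
  by apply: le_trans (dot_abs_le _ _) _; rewrite ler_wpM2l ?enorm_ge0 // enormB.
have E0 := enorm_ge0 (q' - q).
have h3 : enorm (q' - q) / (2 * r) * enorm (q' - q) <= 1 / 8 * enorm (q' - q).
  by rewrite ler_wpM2r // ler_pdivrMr ?mulr_gt0 //; lra.
have h4 : `|dot (q' - q) n| <= 3 / 8 * enorm (q' - q).
  rewrite (_ : n = v + (n - v)); last by rewrite addrC subrK.
  by rewrite {1}dotDr; apply: le_trans (ler_normD _ _) _; lra.
have ww : dot (q' - q) (q' - q) = dot (q' - q) n ^+ 2 + dot (q' - q) (perp n) ^+ 2.
  have pn : dot (perp n) (perp n) = 1 by rewrite perp_unit.
  have np0 : dot n (perp n) = 0 by rewrite dotC dot_perp.
  move: (q' - q) => w; rewrite {1 2}(orth_decomp n (perp n) w n1 pn np0).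
  by rewrite dotDD !dotZZ dotZl dotZr pn n1 np0; ring.
rewrite -(ler_pXn2r (n := 2)) ?nnegrE ?mulr_ge0 // exprMn real_normK ?num_real //.
have : `|dot (q' - q) n| ^+ 2 <= (3 / 8 * enorm (q' - q)) ^+ 2.
  by rewrite ler_pXn2r ?nnegrE // mulr_ge0.
rewrite real_normK ?num_real //; have := sqr_ge0 (dot (q' - q) (perp n)).
by rewrite -enorm_sqr in ww; lra.
Qed.

Lemma near_normal_self : near_normal p n.
Proof.
have rn := r0; split=> //; first by rewrite subrr enorm0; lra.
by rewrite subrr enorm0; lra.
Qed.

Lemma near_normal_ex q : S q -> enorm (q - p) <= r / 8 -> exists v, near_normal q v.
Proof.
move=> Sq qp; have [->|qnp] := eqVneq q p.
  by exists n; exact: near_normal_self.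
have [m [nm nmN _]] := line q Sq.
have key v : nor q v -> nor q (- v) -> 0 <= dot n v -> near_normal q v.
  move=> nv nvN h; split=> //; rewrite enormB.
  have rn := r0.
  have pq : enorm (p - q) <= r by rewrite enormB; lra.
  apply: le_trans (normal_lip r0 p q n v nn nnN nv nvN h _ pq) _.
    by rewrite eq_sym.
  by rewrite mulrAC ler_pdivrMr // enormB; lra.
have [h|h] := leP 0 (dot n m); first by exists m; exact: key.
by exists (- m); apply: key; rewrite ?opprK // dotNr oppr_ge0 ltW.
Qed.

(* The points of [S] near [p] are obtained by projecting the segment through
   [p + t *: n] parallel to the tangent line. *)
Lemma near_normal_surj : exists a, [/\ 0 < a, 64 * a <= r &
  forall s, `|s| < a -> exists q v, near_normal q v /\ dot (q - p) (perp n) = s].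
Proof.
have rn := r0; have [_ n1 _] := nn.
pose tau := perp n; have tau1 : dot tau tau = 1 by rewrite perp_unit.
have nt : dot n tau = 0 by rewrite dotC dot_perp.
pose t := r / 16; have t0 : 0 < t by rewrite divr_gt0.
have tr : t <= r by rewrite /t; lra.
pose X u := p + t *: n + u *: tau.
have dX0 : d (p + t *: n) = t by exact: (normal_dist S0 _ _ _ _ nn (ltW t0) tr).
have x0r : 0 < d (p + t *: n) <= r by rewrite dX0 t0.
have e8 : 0 < 1 / 8 :> R by rewrite divr_gt0.
have [del del0 hdel] := grad_continuous _ _ (diffG _ x0r) _ e8.
rewrite (normal_gradE S0 diffd _ _ _ _ nn t0 tr tr) in hdel.
pose a0 := Num.min (del / 2) (r / 32).
have a00 : 0 < a0 by rewrite lt_min !divr_gt0.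
have a0del u : `|u| <= a0 -> `|u| < del.
  rewrite le_min => /andP[h _]; lra.
have a0r u : `|u| <= a0 -> `|u| <= r / 32.
  by rewrite le_min => /andP[_ h].
have dX u : d (X u) <= t + `|u| /\ t - `|u| <= d (X u).
  have e : enorm (X u - (p + t *: n)) = `|u|.
    by rewrite /X (addrC (p + _)) addrK enormZ (enorm1 _ tau1) mulr1.
  split; first by rewrite -dX0 -e; exact: dist_leD.
  by rewrite lerBlDr -dX0 -e enormB; exact: dist_leD.
have Xr u : `|u| <= a0 -> 0 < d (X u) <= r.
  move=> /a0r h; have [h1 h2] := dX u; rewrite /t in h1 h2.
  by clear -h h1 h2 rn; apply/andP; split; lra.
(* The projection of [X u], written through the gradient so that its continuity in [u] can be read
   off. *)
pose q u := X u - d (X u) *: grad d (X u).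
have qgood u : `|u| <= a0 -> near_normal (q u) (grad d (X u)).
  move=> ua; have ur := Xr u ua; have /andP[d0 dr] := ur.
  have [q' Sq' xq'] := projection S0 clS (X u).
  have nv := normal_grad S0 clS r0 diffd _ _ ur Sq' xq'.
  have [_ XE] := grad_dist S0 _ _ (diffd _ ur) d0 Sq' xq'.
  have qE : q u = q' by rewrite /q {1}XE addrK.
  rewrite -qE in nv Sq'.
  have nvN : nor (q u) (- grad d (X u)).
    by have [m [nm nmN hm]] := line _ Sq'; have [->|->] := hm _ nv; rewrite ?opprK.
  have hn : enorm (grad d (X u) - n) <= 1 / 8.
    have hu : enorm (u *: tau) < del.
      by rewrite enormZ (enorm1 _ tau1) mulr1; exact: a0del.
    exact: hdel hu.
  split=> //; last by apply: le_trans hn _; lra.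
  have [_ v1 _] := nv; have [h1 h2] := dX u; have h3 := a0r u ua.
  have -> : q u - p = t *: (n - grad d (X u))
      + ((t - d (X u)) *: grad d (X u) + u *: tau).
    by rewrite /q /X; apply: row2P; rewrite !mxE; ring.
  apply: le_trans (enormD _ _) _.
  have h4 := enormD ((t - d (X u)) *: grad d (X u)) (u *: tau).
  rewrite !enormZ (enorm1 _ v1) (enorm1 _ tau1) !mulr1 in h4.
  have h5 := dist_window _ _ _ _ h1 h2.
  rewrite enormZ (gtr0_norm t0) enormB.
  have h6 : t * enorm (grad d (X u) - n) <= t * (1 / 8) by rewrite ler_pM2l.
  move: h4; move: (enorm (_ + _)) => E h4.
  rewrite /t in h6 *; lra.
pose beta u := dot (q u - p) tau.
have betaE u : beta u = u - d (X u) * dot (grad d (X u)) tau.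
  rewrite /beta /q /X !dotBl !dotDl !dotZl nt tau1; ring.
(* The Lipschitz bound and the slope bound give [4 / r * |beta u|] for the change of normal, and
   [d (X u) <= 3 / 32 * r] turns this into the factor 3/8. Being below 1, it gives [beta u] the sign
   of [u] at both ends of the segment. *)
have near u : `|u| <= a0 -> `|u - beta u| <= 3 / 8 * `|beta u|.
  move=> ua; have g := qgood u ua.
  have h1 := near_normal_lip _ _ _ _ g near_normal_self.
  have h2 := near_normal_tangent _ _ _ _ near_normal_self g.
  rewrite -/tau -/(beta u) in h2.
  have -> : u - beta u = d (X u) * dot (grad d (X u) - n) tau.
    by rewrite betaE dotBl nt; ring.
  have := Xr u ua => /andP[d0 _]; rewrite normrM (gtr0_norm d0).
  have h3 : `|dot (grad d (X u) - n) tau| <= 4 / r * `|beta u|.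
    apply: le_trans (dot_abs_le _ _) _; rewrite (enorm1 _ tau1) mulr1.
    apply: le_trans h1 _; rewrite (_ : 4 / r * _ = 2 / r * (2 * `|beta u|)); last by ring.
    by rewrite ler_pM2l // divr_gt0.
  have h4 : d (X u) <= 3 / 32 * r.
    have [h5 _] := dX u; have h6 := a0r u ua; rewrite /t in h5.
    lra.
  have -> : 3 / 8 * `|beta u| = (3 / 32 * r) * (4 / r * `|beta u|).
    by field; rewrite gt_eqF.
  by apply: ler_pM => //; exact: ltW.
have bpos : 0 < beta a0.
  have h : `|a0| <= a0 by rewrite gtr0_norm.
  exact: (same_sign _ _ _ (near _ h)).1.
have bneg : beta (- a0) < 0.
  have h : `|- a0| <= a0 by rewrite normrN gtr0_norm.
  by apply: (same_sign _ _ _ (near _ h)).2; rewrite oppr_lt0.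
have cX : continuous X.
  move=> u; apply: (local_lip_continuous _ X u 1 1) => // h _.
  apply: le_trans (norm_le_enorm _) _.
  have -> : X (u + h) - X u = h *: tau.
    by rewrite /X; apply: row2P; rewrite !mxE; ring.
  by rewrite enormZ (enorm1 _ tau1) mulr1 mul1r.
have cbeta u : `|u| <= a0 -> {for u, continuous beta}.
  move=> ua; have ur := Xr u ua.
  have c1 : {for u, continuous (fun c => d (X c))}.
    apply: (continuous_comp (cX u)).
    exact: differentiable_continuous (diffd _ ur).
  have c2 i : {for u, continuous (fun c => grad d (X c) ord0 i)}.
    rewrite (_ : (fun c => grad d (X c) ord0 i) =
      'D_(delta_mx ord0 i) (d : 'rV[R]_2 -> R) \o X); last first.
      by apply/funext => c; exact: grad_coord.
    apply: (continuous_comp (cX u)).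
    exact: differentiable_continuous (diffG _ ur i).
  have cC (c : R) : {for u, continuous (fun _ : R => c)} by exact: cst_continuous.
  rewrite (_ : beta = fun c => c - d (X c) *
      (grad d (X c) ord0 ord0 * tau ord0 ord0
       + grad d (X c) ord0 ord_max * tau ord0 ord_max)); last first.
    by apply/funext => c; exact: betaE.
  apply: (cvgB cvg_id); apply: (cvgM c1).
  by apply: (cvgD (cvgM (c2 _) (cC _)) (cvgM (c2 _) (cC _))).
pose a := Num.min (r / 64) (Num.min (beta a0) (- beta (- a0))).
have aE : a <= a by [].
rewrite {2}/a !le_min in aE; case/and3P: aE => a1 a2 a3.
exists a; split.
- by rewrite !lt_min bpos oppr_gt0 bneg divr_gt0.
- by rewrite mulrC -ler_pdivlMr.
- move=> s; rewrite ltr_norml => /andP[s1 s2].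
  have [|||u] := @IVT R beta (- a0) a0 s.
  + by apply: (@le_trans _ _ 0); rewrite ?oppr_le0 ltW.
  + apply: continuous_in_subspaceT => u; rewrite inE /= in_itv /= => ua.
    by apply: cbeta; rewrite ler_norml.
  + rewrite ge_min le_max; apply/andP; split; apply/orP; [left|right].
      by apply: le_trans (ltW s1); rewrite lerNr.
    by apply: le_trans (ltW s2) a2.
  rewrite in_itv /= => ua us; exists (q u), (grad d (X u)).
  by split; first by apply: qgood; rewrite ler_norml.
Qed.

End LocalGraph.

Theorem theorem3 (R : realType) (S : set 'rV[R]_2) :
  connected S -> interior S = set0 -> prox_C 2 S ->
  (exists p : 'rV[R]_2, S = [set p]) \/ submanifold_C 1 2 S.
Proof.
move=> cS intS [S0 clS [r' r'0 [dC1 dC2]]].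
(* Halving makes the closed condition [d <= r] imply the open one of the hypothesis. *)
pose r := r' / 2; have r0 : 0 < r by rewrite divr_gt0.
have reg x : 0 < dist_to S x <= r -> 0 < dist_to S x < r'.
  by move=> /andP[-> /le_lt_trans]; apply; rewrite /r ltr_pdivrMr // ltr_pMr // ltr1n.
have diffd x : 0 < dist_to S x <= r -> differentiable (dist_to S : 'rV[R]_2 -> R) x.
  by move=> /reg; exact: dC1.
have diffG x : 0 < dist_to S x <= r -> forall i : 'I_2,
    differentiable ('D_(delta_mx ord0 i) (dist_to S : 'rV[R]_2 -> R)) x.
  by move=> /reg xr i; have [h _] := dC2 i; exact: h.
have contH x : 0 < dist_to S x <= r -> forall i j : 'I_2, {for x, continuous
    ('D_(delta_mx ord0 j) ('D_(delta_mx ord0 i) (dist_to S : 'rV[R]_2 -> R)))}.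
  by move=> /reg xr i j; have [_ h] := dC2 i; exact: h.
have [nS|nS] := pselect (exists p, S = [set p]); [by left|right].
have {}nS p : S <> [set p] by move=> Sp; apply: nS; exists p.
have line := normal_line S0 clS r0 diffd diffG
  (antipodal S0 clS r0 diffd intS) cS nS.
move=> p Sp; have [n [nn nnN _]] := line p Sp; have [_ n1 _] := nn.
have [a [a0 ar surj]] := near_normal_surj S0 clS r0 diffd diffG line p n nn nnN.
(* The pair [(0, 0)] is a default value for [|s| >= a], where nothing is claimed. *)
have pick s : exists qv : 'rV[R]_2 * 'rV[R]_2, `|s| < a ->
    near_normal p n qv.1 qv.2 (S := S) (r := r) /\ dot (qv.1 - p) (perp n) = s.
  have [sa|sa] := ltP `|s| a; last by exists (0, 0).
  by have [q [v h]] := surj s sa; exists (q, v).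
have [QN hQN] := choice pick.
pose Q s := (QN s).1; pose N s := (QN s).2.
have nQ s : `|s| < a -> near_normal p n (Q s) (N s) (S := S) (r := r).
  by move=> /hQN[].
have Qt s : `|s| < a -> dot (Q s - p) (perp n) = s by move=> /hQN[].
have tangent := near_normal_tangent r0 p n nn.
have QL s s' : `|s| < a -> `|s'| < a -> enorm (Q s - Q s') <= 2 * `|s - s'|.
  move=> sa sa'; have := tangent _ _ _ _ (nQ _ sa') (nQ _ sa).
  have -> : Q s - Q s' = (Q s - p) - (Q s' - p) by rewrite opprB addrA subrK.
  by rewrite (dotBl (Q s - p)) !Qt.
have hQ s : `|s| < a -> [/\ normal r (Q s) (N s) (S := S),
    normal r (Q s) (- N s) (S := S), dot (Q s - p) (perp n) = s & 3 / 4 <= dot (N s) n].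
  move=> sa; have h := nQ s sa; have [h1 h2 _ _] := h; split=> //; first exact: Qt.
  exact: near_normal_dot nn _ _ h.
have NL s s' : `|s| < a -> `|s'| < a -> enorm (N s - N s') <= 4 / r * `|s - s'|.
  move=> sa sa'; apply: le_trans (near_normal_lip r0 line p n _ _ _ _ (nQ _ sa) (nQ _ sa')) _.
  have -> : 4 / r * `|s - s'| = 2 / r * (2 * `|s - s'|) by ring.
  by rewrite ler_pM2l ?divr_gt0 // QL.
have a00 : `|0 : R| < a by rewrite normr0.
have pself := near_normal_self r0 p n nn nnN.
have Q0 : Q 0 = p.
  apply/subr0_eq/enorm_eq0/eqP; rewrite eq_le enorm_ge0 andbT.
  by have := tangent _ _ _ _ pself (nQ 0 a00); rewrite Qt // normr0 mulr0.
apply: (graph_chart S p n a (r / 32) (fun s => dot (Q s - p) n)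
  (fun s => - dot (N s) (perp n) / dot (N s) n)
  (fun s => - hess (dist_to S) (Q s + (r / 2) *: N s) (perp (N s)) (perp (N s)) /
     ((1 - r / 2 * hess (dist_to S) (Q s + (r / 2) *: N s) (perp (N s)) (perp (N s)))
        * dot (N s) n ^+ 3))) => //.
- by rewrite divr_gt0.
- by rewrite Q0 subrr dot0l.
- move=> s sa; exact: (graph_derive r0 p n a Q N n1 hQ QL).
- move=> s sa; exact: (graph_derive2 S0 r0 diffd diffG p n a Q N n1 hQ QL NL).
- move=> s sa; exact: (graph_derive2_continuous S0 r0 diffd diffG contH p n a Q N n1 hQ QL NL).
- move=> x; set s := dot (x - p) (perp n) => sa xg; have Qs := nQ s sa.
  have pn1 : dot (perp n) (perp n) = 1 by rewrite perp_unit.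
  have dec y := orth_decomp (perp n) n y pn1 n1 (dot_perp n).
  split=> [Sx|xE].
    (* The tangential coordinate is below [r / 64], the height of [Q s] at most [2 * |s| <= r / 32],
       and the vertical window is [r / 32]; the sum is within the range of [near_normal_ex]. *)
    have hx : enorm (x - p) <= r / 8.
      rewrite (dec (x - p)) -/s; apply: le_trans (enormD _ _) _.
      rewrite !enormZ (enorm1 _ n1) (enorm1 _ pn1) !mulr1.
      have h1 := tangent _ _ _ _ pself Qs; rewrite Qt // in h1.
      have h2 := dot_abs_le (Q s - p) n; rewrite (enorm1 _ n1) mulr1 in h2.
      have := ler_normD (dot (x - p) n - dot (Q s - p) n) (dot (Q s - p) n).
      rewrite subrK; move: (`|dot _ _|) xg sa h1 h2 => A; lra.
    have [v nx] := near_normal_ex r0 line p n nn nnN x Sx hx.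
    (* [x] and [Q s] have the same tangential coordinate, so the slope bound makes them equal. *)
    have := tangent _ _ _ _ Qs nx.
    have -> : x - Q s = (x - p) - (Q s - p) by rewrite opprB addrA subrK.
    rewrite (dotBl (x - p)) Qt // -/s subrr normr0 mulr0 => h0.
    have : (x - p) - (Q s - p) = 0.
      by apply/enorm_eq0/eqP; rewrite eq_le h0 enorm_ge0.
    by move=> /subr0_eq ->.
  have [[SQ _ _] _ _ _] := Qs.
  rewrite -(subrK p x) (dec (x - p)) -/s xE -{1}(Qt s sa) -dec subrK //.
Qed.
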